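(* Let $k$ be the number of parties, let $q\in(0,1)$ be the sampling probability of SGD, and let $T_j$ be the number of epochs of party $\mathcal{P}_j$ for each $j\in\{1,\dots,k\}$. Then there exist constants $c_1>0$ and $c_2>0$ such that for every $\varepsilon$ with $0<\varepsilon<c_1q^2\sum_{j=1}^kT_j$ and every $\delta\in(0,1]$, the training algorithm FedOnce-L1 (defined in the context) run with noise scale $\sigma$ is $(\varepsilon,\delta)$-differentially private whenever $$\sigma\ \ge\ c_2\,\frac{q\sqrt{\log(1/\delta)\,\sum_{j=1}^kT_j}}{\varepsilon}.$$
   Context: **Differential privacy.** A randomized mechanism $\mathcal{M}:\mathcal{D}\to\mathcal{R}$ is $(\varepsilon,\delta)$-differentially private if for all neighboring datasets $D,D'\in\mathcal{D}$, i.e. $\|D-D'\|\le 1$ (one is obtained from the other by adding or removing at most one record), and all (measurable) $S\subseteq\mathcal{R}$, $\Pr[\mathcal{M}(D)\in S]\le e^{\varepsilon}\Pr[\mathcal{M}(D')\in S]+\delta$. **Data.** A dataset is $D=\{(\mathbf{x}_i,y_i)\}_i$ with features $\mathbf{x}_i=[\mathbf{x}_i^1,\dots,\mathbf{x}_i^k]$ split among $k\ge 2$ parties; party $\mathcal{P}_j$ holds $\mathbf{x}^j=\{\mathbf{x}_i^j\}_i$. Party $\mathcal{P}_1$ (the host) also holds the labels $\mathbf{y}=\{y_i\}_i$; parties $\mathcal{P}_2,\dots,\mathcal{P}_k$ are guests. Fixed, data-independent parameters are: a normalizing number $n$ (number of samples), a clipping threshold $\Omega>0$, a noise scale $\sigma$,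 learning rates $\eta^{(t)}$, model architectures $f_{\theta_j}$ ($j=2,\dots,k$) and $f_w$ (functions differentiable in their parameters), initial parameters, and a representation dimension $d$. **Noisy update.** One noisy update of a parameter vector $\theta$ at step $t$ with gradient $\mathbf{g}$ is $$\mathbf{g}_{clip}=\mathbf{g}/\max(1,\|\mathbf{g}\|_2/\Omega),\qquad \mathbf{g}_{noise}=\mathbf{g}_{clip}+\mathcal{N}(0,\sigma^2\Omega^2\mathbf{I}),\qquad \theta^{(t+1)}=\theta^{(t)}-\eta^{(t)}\mathbf{g}_{noise},$$ with fresh independent Gaussian noise each time. **FedOnce-L1.** In each epoch a random batch $J$ of sample indices is drawn, each index being included independently with probability $q$, and one noisy update is made with the gradient of the batch loss. Batches, targets and noises are independent across epochs and parties. *Guest party $j\in\{2,\dots,k\}$.* Random targets $C_j$ (a random matrix with one row in $\mathbb{R}^d$ per sample index, generated independently of the data) are drawn once. For $t=1,\dots,T_j$, with batch $J$: - $\tilde P^{(t)}$ is a permutation matrix $P$ of size $|J|\times|J|$ minimizing $\frac{1}{2n}\|f_{\theta_j^{(t)}}(\mathbf{x}^j_J)-P\,C_{j,J}\|_F^2$, where the subscript $J$ means restriction to the rows indexed by $J$ and ties are broken by a fixed rule; - the gradient $\mathbf{g}^{(t)}=\nabla_{\theta_j}\frac{1}{2n}\|f_{\theta_j}(\mathbf{x}^j_J)-\tilde P^{(t)}C_{j,J}\|_F^2$ is evaluated at $\theta_j^{(t)}$, with $\tilde P^{(t)}$ held fixed; - $\theta_j$ is updated by one noisy update. After $T_j$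 epochs, with final parameters $\theta_j$, the guest sends the representation $R_j=f_{\theta_j}(\mathbf{x}^j)$ (computed row by row, one row per sample) to the host, who is trusted. *Host party.* For $t=1,\dots,T_1$, with batch $J$, the host computes the gradient $\mathbf{g}^{(t)}=\nabla_w\frac{1}{2n}\|f_w(\mathbf{x}^1_J,R_{2,J},\dots,R_{k,J})-\mathbf{y}_J\|_F^2$ at $w^{(t)}$ and performs one noisy update of $w$. *Output (released).* The final parameters $(\theta_2,\dots,\theta_k,w)$. The representations $R_j$ are not released. FedOnce-L1 being $(\varepsilon,\delta)$-differentially private means that the randomized map from $D$ to this output is. *)

(* Defs.v *)
From HB Require Import structures.
From mathcomp Require Import all_boot all_order all_algebra all_fingroup finmap.
From mathcomp Require Import all_classical all_reals all_analysis.

Set Implicit Arguments.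
Unset Strict Implicit.
Unset Printing Implicit Defensive.
Import Order.TTheory GRing.Theory Num.Theory.
Import numFieldNormedType.Exports.
Local Open Scope classical_set_scope.
Local Open Scope ring_scope.

Definition sigma_of (T I : Type) (d : measure_display) (U : measurableType d)
    (X : I -> T -> U) : set_system T :=
  <<s \bigcup_i preimage_set_system setT (X i) measurable >>.

Section Probability.
Context (R : realType) (disp : measure_display) (W : measurableType disp).
Variable P : probability W R.

Definition mutually_independent (I : choiceType) (F : I -> set_system W) :=
  forall (A : {fset I}) (E : I -> set W),
    (forall i, i \in A -> F i (E i)) ->
    P (\bigcap_(i in [set` A]) E i) = (\prod_(i <- A) P (E i))%E.

(* Agreement is only asked on measurable sets: on the other ones both sides are
   junk values. *)
Definition has_law (d : measure_display) (U : measurableType d)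
    (X : {RV P >-> U}) (mu : set U -> \bar R) :=
  forall B, measurable B -> distribution P X B = mu B.

End Probability.

(* [law D] is the distribution of the mechanism run on [D], [events] the
   measurable sets of outputs. *)
Definition differentially_private (R : realType) (data out : Type)
    (nbr : data -> data -> Prop) (events : set_system out)
    (law : data -> set out -> \bar R) (eps delta : R) :=
  forall D D' : data, nbr D D' -> forall S : set out, events S ->
    (law D S <= (expR eps)%:E * law D' S + delta%:E)%E.

Section NoisyUpdate.
Variable R : realType.

(* The library norm on matrices is the max norm. *)
Definition norm2 (p : nat) (v : 'rV[R]_p) : R :=
  Num.sqrt (\sum_i v 0 i ^+ 2).

Definition frobenius (m n : nat) (A : 'M[R]_(m, n)) : R :=
  Num.sqrt (\sum_i \sum_j A i j ^+ 2).

Definition gradient (p : nat) (L : 'rV[R]_p -> R) (th : 'rV[R]_p) : 'rV[R]_p :=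
  \row_c 'D_(delta_mx 0 c) L th.

Definition clip (p : nat) (Om : R) (v : 'rV[R]_p) : 'rV[R]_p :=
  (Num.max 1 (norm2 v / Om))^-1 *: v.

(* [z] is a standard Gaussian vector, so that [sigma * Om *: z] has law
   N(0, sigma^2 Om^2 I); [normal_prob 0 (sigma * Om)] would not be the Dirac
   mass at 0 when [sigma = 0]. *)
Definition noisy_update (p : nat) (Om sigma eta : R) (v z th : 'rV[R]_p) :
    'rV[R]_p :=
  th - eta *: (clip Om v + (sigma * Om) *: z).

Fixpoint train (p : nat) (step : nat -> 'rV[R]_p -> 'rV[R]_p) (th0 : 'rV[R]_p)
    (t : nat) : 'rV[R]_p :=
  if t is t'.+1 then step t' (train step th0 t') else th0.

End NoisyUpdate.

(* There are [g] guests, hence [g.+1] parties: the host is party [ord0] and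
   guest [j : 'I_g] is party [lift ord0 j]. *)
Record setup (R : realType) (g : nat) := Setup {
  feat : 'I_g -> Type;
  hfeat : Type;
  ldim : nat;
  rdim : nat;
  pdim : 'I_g -> nat;
  wdim : nat;
  (* f_{theta_j} and f_w, applied row by row; the matrix argument of the host
     model has the representation of guest j as its j-th row *)
  gmodel : forall j, 'rV[R]_(pdim j) -> feat j -> 'rV[R]_rdim;
  hmodel : 'rV[R]_wdim -> hfeat -> 'M[R]_(g, rdim) -> 'rV[R]_ldim;
  ginit : forall j, 'rV[R]_(pdim j);
  winit : 'rV[R]_wdim;
  nnorm : nat;
  clipping : R;
  rate : nat -> R;
  tie : forall m, {set 'S_m} -> 'S_m
}.

Section FedOnce.
Variables (R : realType) (g : nat) (s : setup R g).
Local Notation d := (rdim s).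

(* Measurability of [hmodel] in the representations is what makes the host's
   training a random variable: these are themselves random. *)
Definition admissible : Prop :=
  [/\ (0 < nnorm s)%N,
      0 < clipping s,
      forall (m : nat) (A : {set 'S_m}), A != finset.set0 -> tie s A \in A,
      forall j (x : feat s j) (th : 'rV[R]_(pdim s j)),
        differentiable (fun th' => gmodel th' x) th &
      (forall (x : hfeat s) (r : 'M[R]_(g, d)) (w : 'rV[R]_(wdim s)),
         differentiable (fun w' => hmodel w' x r) w) /\
      (forall (x : hfeat s) (w : 'rV[R]_(wdim s)) (c : 'I_(ldim s)) (B : set R),
         measurable B ->
         sigma_of (fun (ij : 'I_g * 'I_d) (r : 'M[R]_(g, d)) => r ij.1 ij.2)
           [set r | B (hmodel w x r 0 c)])].

Record sample := Sample {
  gx : forall j, feat s j;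
  hx : hfeat s;
  label : 'rV[R]_(ldim s)
}.

Definition dataset := {fmap nat -> sample}.

(* [D.[~ i]] is [D] itself when [i] is not an index of [D]. *)
Definition neighbors (D D' : dataset) : Prop :=
  exists i : nat, D' = D.[~ i]%fmap \/ D = D'.[~ i]%fmap.

Definition records (D : dataset) : seq (nat * sample) :=
  pmap (fun i => omap (pair i) D.[? i]%fmap) (sort leq (domf D)).

(* A realization of all the randomness: [targets j i] is the row of C_j for
   sample index [i], [bits k t i] tells whether index [i] is drawn by party [k]
   at epoch [t], and [noises k t c] is the [c]-th coordinate of the noise of
   party [k] at epoch [t]. Only finitely many entries are used on a dataset. *)
Record seed := Seed {
  targets : 'I_g -> nat -> 'rV[R]_d;
  bits : 'I_g.+1 -> nat -> nat -> bool;
  noises : 'I_g.+1 -> nat -> nat -> R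
}.

Definition batch (D : dataset) (r : seed) (k : 'I_g.+1) (t : nat) :
    seq (nat * sample) :=
  [seq e <- records D | bits r k t e.1].

Definition noise (p : nat) (r : seed) (k : 'I_g.+1) (t : nat) : 'rV[R]_p :=
  \row_c noises r k t c.

Section Guest.
Variables (j : 'I_g) (C : nat -> 'rV[R]_d) (J : seq (nat * sample)).

Definition guest_loss (pi : 'S_(size J)) (th : 'rV[R]_(pdim s j)) : R :=
  (2 * (nnorm s)%:R)^-1 *
  frobenius ((\matrix_a gmodel th (gx (tnth (in_tuple J) a).2 j))
             - perm_mx pi *m (\matrix_a C (tnth (in_tuple J) a).1)) ^+ 2.

Definition assignment (th : 'rV[R]_(pdim s j)) : 'S_(size J) :=
  tie s [set pi | [forall pi', guest_loss pi th <= guest_loss pi' th]]%SET.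

Definition guest_gradient (th : 'rV[R]_(pdim s j)) : 'rV[R]_(pdim s j) :=
  gradient (guest_loss (assignment th)) th.

End Guest.

Definition host_loss (rep : sample -> 'M[R]_(g, d)) (J : seq (nat * sample))
    (w : 'rV[R]_(wdim s)) : R :=
  (2 * (nnorm s)%:R)^-1 *
  frobenius ((\matrix_(a < size J)
                let x := (tnth (in_tuple J) a).2 in hmodel w (hx x) (rep x))
             - (\matrix_(a < size J) label (tnth (in_tuple J) a).2)) ^+ 2.

Section Run.
Variables (T : 'I_g.+1 -> nat) (sigma : R) (D : dataset) (r : seed).

Definition guest_final (j : 'I_g) : 'rV[R]_(pdim s j) :=
  let k := lift ord0 j in
  train (fun t th =>
           noisy_update (clipping s) sigma (rate s t)
             (guest_gradient (targets r j) (batch D r k t) th)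
             (noise _ r k t) th)
        (ginit s j) (T k).

Definition representation (x : sample) : 'M[R]_(g, d) :=
  \matrix_j gmodel (guest_final j) (gx x j).

Definition host_final : 'rV[R]_(wdim s) :=
  train (fun t w =>
           noisy_update (clipping s) sigma (rate s t)
             (gradient (host_loss representation (batch D r ord0 t)) w)
             (noise _ r ord0 t) w)
        (winit s) (T ord0).

Definition output : Type :=
  ((forall j, 'rV[R]_(pdim s j)) * 'rV[R]_(wdim s))%type.

Definition fedonce : output := (guest_final, host_final).

End Run.

(* The Borel sets of the finite-dimensional space of outputs. *)
Definition output_events : set_system output :=
  sigma_of (fun (a : {j : 'I_g & 'I_(pdim s j)} + 'I_(wdim s)) (o : output) =>
    match a with
    | inl jc => o.1 (tag jc) 0 (tagged jc)
    | inr c => o.2 0 c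
    end).

Section Randomness.
Context (disp : measure_display) (W : measurableType disp).
Variable P : probability W R.

Record random_seed := RandomSeed {
  rtargets : 'I_g -> nat -> 'I_d -> {RV P >-> R};
  rbits : 'I_g.+1 -> nat -> nat -> {RV P >-> bool};
  rnoises : 'I_g.+1 -> nat -> nat -> {RV P >-> R}
}.

Definition seed_at (X : random_seed) (om : W) : seed :=
  Seed (fun j i => \row_c rtargets X j i c om)
       (fun k t i => rbits X k t i om)
       (fun k t c => rnoises X k t c om).

Definition source : Type :=
  ('I_g + 'I_g.+1 * nat * nat + 'I_g.+1 * nat * nat)%type.

Definition source_events (X : random_seed) (a : source) : set_system W :=
  match a with
  | inl (inl j) => sigma_of (fun ic : nat * 'I_d => rtargets X j ic.1 ic.2 : W -> R)
  | inl (inr (k, t, i)) => preimage_set_system setT (rbits X k t i) measurable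
  | inr (k, t, c) => preimage_set_system setT (rnoises X k t c) measurable
  end.

(* The entries of a target matrix may have any joint law. *)
Definition seed_law (q : R) (X : random_seed) : Prop :=
  [/\ forall k t i, has_law (rbits X k t i) (bernoulli_prob q),
      forall k t c, has_law (rnoises X k t c) (normal_prob 0 1) &
      mutually_independent P (source_events X)].

Definition fedonce_law (T : 'I_g.+1 -> nat) (sigma : R) (X : random_seed)
    (D : dataset) (S : set output) : \bar R :=
  P [set om | S (fedonce T sigma D (seed_at X om))].

End Randomness.
End FedOnce.

(* Main.v *)
(* The constants may depend on q and on N = T_1 + ... + T_k.  Two arguments
   share the range of delta.
   Small delta: whatever the two datasets, two clipped gradients are at distance
   at most 2 Omega, so the run on D with noise z reaches the same parameters as
   the run on D' with noise z + h(z), where each coordinate of h depends on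
   earlier noise only and |h|^2 <= 4 N / sigma^2.  Changing variables coordinate
   by coordinate (Cameron-Martin in dimension one) and bounding the exponential
   moments of the privacy loss gives (eps, delta)-privacy with
   delta = exp (l (l + 1) / 2 * 4 N / sigma^2 - l eps), for every l >= 0.
   Delta close to 1: then log(1/delta), hence sigma, may be arbitrarily small and
   the noise does not suffice.  But with probability (1 - q)^N the differing
   record is in no batch, so the total variation distance is at most
   1 - (1 - q)^N; this settles delta >= 1 - (1 - q)^N.  Below that threshold
   log(1/delta) is bounded away from 0, and with eps <= 1 and c_2 large enough
   the first argument applies. *)
Require Import Defs.
From HB Require Import structures.
From mathcomp Require Import all_boot all_order all_algebra all_fingroup finmap.
From mathcomp Require Import all_classical all_reals all_analysis.
From mathcomp Require Import measurable_realfun ring lra.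

Set Implicit Arguments.
Unset Strict Implicit.
Unset Printing Implicit Defensive.
Import Order.TTheory GRing.Theory Num.Theory.
Import numFieldNormedType.Exports.
Local Open Scope classical_set_scope.
Local Open Scope ring_scope.

(** * Coordinates and the Gaussian law *)

Section Coordinates.
Context {R : realType}.

Lemma sigma_of_gen (T I : Type) (d : measure_display) (U : measurableType d)
    (X : I -> T -> U) (i : I) (B : set U) :
  measurable B -> sigma_of X (X i @^-1` B).
Proof.
move=> mB; apply: sub_sigma_algebra; exists i => //.
by exists B => //; rewrite setTI.
Qed.

(** The sets with preimage in [G] form a sigma-algebra, so generators suffice. [G] is kept abstract
    because it will also be the sigma-algebra generated by cylinders. *)
Lemma sigma_of_preimage_sub (T T' I : Type) (d : measure_display)
    (U : measurableType d) (X : I -> T -> U) (f : T' -> T)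
    (G : set_system T') (S : set T) : sigma_algebra setT G ->
  (forall i B, measurable B -> G (f @^-1` (X i @^-1` B))) -> sigma_of X S ->
  G (f @^-1` S).
Proof.
move=> sG GX sS; rewrite -[f @^-1` S]setTI.
suff : image_set_system setT f G S by [].
apply: (smallest_sub _ _ sS); first exact: sigma_algebra_image.
by move=> _ [i _ [B mB <-]]; rewrite /image_set_system /= !setTI; exact: GX.
Qed.

Lemma sigma_of_preimage (T I : Type) (d d' : measure_display)
    (U : measurableType d) (W : measurableType d') (X : I -> T -> U)
    (f : W -> T) (S : set T) :
  (forall i, measurable_fun setT (X i \o f)) -> sigma_of X S ->
  measurable (f @^-1` S).
Proof.
move=> mX; apply: sigma_of_preimage_sub; first exact: sigma_algebra_measurable.
by move=> i B mB; rewrite -[X in measurable X]setTI; exact: mX.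
Qed.

(** The space of all functions from [A] to the reals with its product sigma-algebra; [A] may be
    infinite. *)
Definition coords (A : Type) := g_sigma_algebraType
  (\bigcup_a preimage_set_system setT (fun v : A -> R => v a) measurable).

Lemma measurable_coord (A : Type) (a : A) :
  measurable_fun setT (fun v : coords A => v a).
Proof.
move=> _ B mB; rewrite setTI.
exact: (@sigma_of_gen (A -> R) A _ _ (fun a v => v a) a B mB).
Qed.

Lemma measurable_coords (A : Type) (d : measure_display) (W : measurableType d)
    (f : W -> coords A) :
  (forall a, measurable_fun setT (fun w => f w a)) -> measurable_fun setT f.
Proof. by move=> mf _ B mB; rewrite setTI; exact: sigma_of_preimage mB. Qed.

Definition upd (A : eqType) (a : A) (x : R) (v : A -> R) : A -> R :=
  fun b => if b == a then x else v b.

Lemma measurable_upd (A : eqType) (a : A) (d : measure_display)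
    (W : measurableType d) (x : W -> R) (v : W -> coords A) :
  measurable_fun setT x -> measurable_fun setT v ->
  measurable_fun setT (fun w => upd a (x w) (v w) : coords A).
Proof.
move=> mx mv; apply: measurable_coords => b; rewrite /upd.
by case: eqP => // _; exact: (measurableT_comp (measurable_coord b)).
Qed.

End Coordinates.

Section Gaussian.
Context {R : realType}.
Local Notation mu := (@lebesgue_measure R).
Local Open Scope ereal_scope.

Import HBNNSimple.

(** For simple functions this is checked on each level set; monotone convergence along
    [nnsfun_approx] gives the general case. *)
Lemma ge0_integral_normal_prob (m s : R) (f : measurableTypeR R -> \bar R) :
  measurable_fun setT f -> (forall x, 0 <= f x) ->
  \int[normal_prob m s]_x f x = \int[mu]_x (f x * (normal_pdf m s x)%:E).
Proof.
move=> mf f0.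
have mp : measurable_fun setT (fun x => (normal_pdf m s x)%:E).
  by apply/measurable_EFinP; exact: measurable_normal_pdf.
have p0 x : 0 <= (normal_pdf m s x)%:E by rewrite lee_fin normal_pdf_ge0.
have mpre (h : {nnsfun measurableTypeR R >-> R}) r : measurable (h @^-1` [set r]).
  exact: measurable_funPTI.
have simple (h : {nnsfun measurableTypeR R >-> R}) :
    \int[normal_prob m s]_x (h x)%:E =
    \int[mu]_x ((h x)%:E * (normal_pdf m s x)%:E).
  under eq_integral do rewrite fimfunE -fsumEFin//.
  rewrite ge0_integral_fsum//; last 2 first.
    - by move=> r; apply/measurable_EFinP; exact: measurable_funM.
    - by move=> n x _; rewrite EFinM nnfun_muleindic_ge0.
  under [RHS]eq_integral.
    move=> x _; rewrite fimfunE -fsumEFin// ge0_mule_fsuml; last first.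
      by move=> r; rewrite EFinM nnfun_muleindic_ge0.
    over.
  rewrite ge0_integral_fsum//; last 2 first.
    - move=> r; apply: emeasurable_funM => //.
      by apply/measurable_EFinP; exact: measurable_funM.
    - by move=> n x _; rewrite mule_ge0// EFinM nnfun_muleindic_ge0.
  apply: eq_fsbigr => r _.
  rewrite integralZl_indic_nnsfun// integral_indic//= setIT.
  rewrite /normal_prob integral_mkcond/=.
  (* A nonnegative simple function does not take a negative value [r], so both sides vanish;
     otherwise [r] can be moved in and out of the integral. *)
  have [r0|r0] := ltP r 0%R.
    rewrite preimage_nnfun0// patch_set0 integral0 mule0; apply/esym/integral0_eq.
    by move=> x _; rewrite indic0/= mulr0 mul0e.
  rewrite -ge0_integralZl//; last 2 first.
    - by apply/(measurable_restrictT _ (mpre h r)); exact: measurable_funTS.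
    - by move=> x _; rewrite patchE; case: ifP.
  apply: eq_integral => x _; rewrite patchE indicE.
  by case: ifP => _ /=; rewrite ?(mulr1, mulr0, mul0e, mule0).
pose f_ := nnsfun_approx measurableT mf.
transitivity (lim (\int[normal_prob m s]_x (f_ n x)%:E @[n --> \oo])).
  rewrite -monotone_convergence//=.
  - apply: eq_integral => x _; apply/esym/cvg_lim => //=.
    exact: cvg_nnsfun_approx.
  - by move=> n; apply/measurable_EFinP; exact: measurable_funTS.
  - by move=> n ? _; rewrite lee_fin.
  - by move=> ? _ ? ? mn; rewrite lee_fin; exact/lefP/nd_nnsfun_approx.
transitivity (lim (\int[mu]_x ((f_ n x)%:E * (normal_pdf m s x)%:E)
    @[n --> \oo])).
  have -> // : (fun n => \int[normal_prob m s]_x (f_ n x)%:E) =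
      fun n => \int[mu]_x ((f_ n x)%:E * (normal_pdf m s x)%:E).
  by apply/funext => n; exact: simple.
rewrite -monotone_convergence//=.
- apply: eq_integral => x _; apply/cvg_lim => //=.
  apply: cvgeZr => //; exact: cvg_nnsfun_approx.
- by move=> n; apply: emeasurable_funM => //; exact/measurable_EFinP.
- by move=> n x _; rewrite mule_ge0// lee_fin.
- move=> x _ a b ab; apply: lee_wpmul2r => //.
  by rewrite lee_fin; exact/lefP/nd_nnsfun_approx.
Qed.

(** The image of Lebesgue measure under translation gives half-open intervals their length, hence is
    Lebesgue measure. *)
Lemma ge0_integral_translation (h : R) (f : R -> \bar R) :
  measurable_fun setT f -> (forall x, 0 <= f x) ->
  \int[mu]_x f (x + h)%R = \int[mu]_x f x.
Proof.
move=> mf f0.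
pose t := (fun x : R => x + h)%R : measurableTypeR R -> measurableTypeR R.
have mt : measurable_fun setT t.
  have : measurable_fun [set: R] (fun x : R => x + h)%R by exact: measurable_funD.
  by [].
transitivity (\int[pushforward mu t]_x f x).
  have := @ge0_integral_pushforward _ _ _ _ R t mt mu setT f measurableT mf
    (fun x _ => f0 x).
  by rewrite preimage_setT => ->.
apply: eq_measure_integral => A mA _; apply/esym.
apply: lebesgue_measure_unique => //= _ [[a b]] _ <-.
rewrite /pushforward (_ : t @^-1` _ = `]a - h, b - h]%classic)%R; last first.
  by apply/seteqP; split => x; rewrite /t /= !in_itv /= ltrBlDr lerBrDr.
rewrite !lebesgue_measure_itv/= !lte_fin ltrD2r; case: ifP => // _.
by rewrite -!EFinB; congr EFin; ring.
Qed.

(** Cameron-Martin in dimension one: the exponential factor times the Gaussian density at [x] is the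
    density at [x + h], and Lebesgue measure is translation invariant. *)
Lemma normal_prob_shift (h : R) (f : R -> \bar R) :
  measurable_fun setT f -> (forall x, 0 <= f x) ->
  \int[normal_prob 0 1]_x ((expR (- (h * x) - h ^+ 2 / 2))%:E * f (x + h)%R) =
  \int[normal_prob 0 1]_x f x.
Proof.
move=> mf f0.
have mE : measurable_fun setT (fun x : R => expR (- (h * x) - h ^+ 2 / 2)).
  apply: (measurableT_comp (@measurable_expR R)).
  by apply: measurable_funB => //; apply: measurable_funN; exact: measurable_funM.
rewrite !ge0_integral_normal_prob//; last 2 first.
- apply: emeasurable_funM; last exact: measurableT_comp (measurable_funD _ _).
  by apply/measurable_EFinP; exact: mE.
- by move=> x; rewrite mule_ge0// lee_fin expR_ge0.
rewrite -[RHS](ge0_integral_translation h); last 2 first.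
- apply: emeasurable_funM => //; apply/measurable_EFinP.
  exact: measurable_normal_pdf.
- by move=> x; rewrite mule_ge0// lee_fin normal_pdf_ge0.
apply: eq_integral => x _; rewrite muleAC muleC; congr (_ * _).
rewrite -EFinM !normal_pdfE ?oner_eq0//= mulrCA /normal_fun -expRD.
by congr ((_ * expR _)%:E); field.
Qed.

Lemma normal_prob_mgf (a : R) :
  \int[normal_prob 0 1]_x (expR (a * x - a ^+ 2 / 2))%:E = 1.
Proof.
have mc : measurable_fun [set: R] (cst 1 : R -> \bar R) by exact: measurable_cst.
have := normal_prob_shift (- a)%R mc (fun=> lee01).
rewrite integral_cst//= mul1e probability_setT => <-.
by apply: eq_integral => x _; rewrite mule1 sqrrN mulNr opprK.
Qed.

End Gaussian.

(** * Shifting Gaussian coordinates one at a time *)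

Section GaussianAverages.
Context {R : realType} {A : eqType}.
Local Notation gamma := (normal_prob (0 : R) 1).
Local Notation V := (@coords R A).
Implicit Types (cs : seq A) (F : V -> \bar R) (v w : V).
Local Open Scope ereal_scope.

(** Iterated integrals rather than a product measure: an inner coordinate can then be shifted by an
    amount depending on the outer ones. *)
Fixpoint avg cs F v : \bar R :=
  if cs is a :: cs' then \int[gamma]_x avg cs' F (upd a x v) else F v.

Lemma measurable_avg cs F : (forall v, 0 <= F v) -> measurable_fun setT F ->
  measurable_fun setT (avg cs F).
Proof.
move=> F0 mF; elim: cs => //= a cs IH.
pose f (z : V * R) := avg cs F (upd a z.2 z.1).
apply: (measurable_fun_fubini_tonelli_F (m2 := gamma) f).
  apply: (measurableT_comp IH); exact: measurable_upd.
move=> z; rewrite /f; elim: cs (upd _ _ _) {IH f} => //= b cs IH v.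
by apply: integral_ge0 => x _; exact: IH.
Qed.

Lemma avg_ge0 cs F v : (forall v, 0 <= F v) -> 0 <= avg cs F v.
Proof.
move=> F0; elim: cs v => //= a cs IH v.
by apply: integral_ge0 => x _; exact: IH.
Qed.

Lemma measurable_avg_upd cs F (a : A) v :
  (forall v, 0 <= F v) -> measurable_fun setT F ->
  measurable_fun setT (fun x => avg cs F (upd a x v)).
Proof.
move=> F0 mF; apply: (measurableT_comp (measurable_avg cs F0 mF)).
exact: measurable_upd.
Qed.

Variable h : A -> V -> R.

Definition shifted cs v : V := fun b => if b \in cs then (v b + h b v)%R else v b.

(* Coordinates are revealed in the order of the list: the shift of a coordinate
   may only depend on the coordinates outside the list and on earlier ones. *)
Fixpoint predictable cs : Prop :=
  if cs is a :: cs' then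
    (forall v v', (forall c, c \notin cs -> v c = v' c) -> h a v = h a v') /\
    predictable cs'
  else True.

Lemma predictable_cat s cs b v v' : predictable (s ++ cs) -> b \in s ->
  (forall c, c \notin cs -> v c = v' c) -> h b v = h b v'.
Proof.
elim: s => //= a s IH [ha hs]; rewrite inE => /predU1P[->|/IH]; last exact.
by move=> vv'; apply: ha => c; rewrite inE mem_cat !negb_or => /and3P[_ _ /vv'].
Qed.

(* [v] is the noise seen by the shifted process and [w] its shift. *)
Fixpoint savg cs F v w : \bar R :=
  if cs is a :: cs' then
    \int[gamma]_x savg cs' F (upd a x v) (upd a (x + h a v)%R w)
  else F w.

(** [s] holds the coordinates revealed so far, and the induction moves the head of [cs] to its end.
    The invariant is that [w] is the shifted noise off [cs]; predictability preserves it, since a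
    new value changes no shift already used. *)
Lemma avg_shift s cs F v w : predictable (s ++ cs) ->
  (forall b, b \notin cs -> w b = shifted (s ++ cs) v b) ->
  avg cs (F \o shifted (s ++ cs)) v = savg cs F v w.
Proof.
elim: cs s v w => [|a cs IH] s v w hp wv /=.
  by congr F; apply/funext => b; rewrite wv.
apply: eq_integral => x _; move: hp wv; rewrite -cat_rcons => hp wv.
apply: IH => // b bcs; rewrite /shifted /upd.
case: (eqVneq b a) => [->|ba].
  (* The shift of [a] does not read [a] itself, so it is the same before and after the update of
     [v]. *)
  rewrite mem_cat mem_rcons mem_head/=; congr (_ + _)%R.
  move: hp; rewrite cat_rcons => hp.
  have {}hp : predictable (a :: cs) by elim: {wv} s hp => //= c s IHs [_ /IHs].
  by apply: hp.1 => c; rewrite inE negb_or => /andP[/negbTE ->].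
rewrite wv ?inE ?negb_or ?ba// /shifted; case: ifP => // bs; congr (_ + _)%R.
move: bs; rewrite mem_cat (negbTE bcs) orbF mem_rcons inE (negbTE ba)/= => bs.
apply: (@predictable_cat s (a :: cs)) => //; first by rewrite -cat_rcons.
by move=> c; rewrite inE negb_or => /andP[/negbTE ->].
Qed.

Hypothesis mh : forall a, measurable_fun setT (h a).

Lemma measurable_savg cs F : (forall v, 0 <= F v) -> measurable_fun setT F ->
  measurable_fun setT (fun z : V * V => savg cs F z.1 z.2).
Proof.
move=> F0 mF; elim: cs => [|a cs IH] /=; first exact: measurableT_comp.
pose f (z : V * V * R) :=
  savg cs F (upd a z.2 z.1.1) (upd a (z.2 + h a z.1.1)%R z.1.2).
apply: (measurable_fun_fubini_tonelli_F (m2 := gamma) f).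
  have m1 : measurable_fun setT (fun z : V * V * R => z.1.1).
    exact: measurableT_comp.
  have m2 : measurable_fun setT (fun z : V * V * R => z.1.2).
    exact: measurableT_comp.
  apply: (@measurableT_comp _ _ _ _ _ _ (fun z : V * V => savg cs F z.1 z.2) _
    (fun z : V * V * R =>
       (upd a z.2 z.1.1 : V, upd a (z.2 + h a z.1.1)%R z.1.2 : V))) => //.
  apply: measurable_fun_pair; apply: measurable_upd => //.
  by apply: measurable_funD => //; exact: measurableT_comp.
move=> z; rewrite /f; elim: cs (upd _ _ _) (upd _ _ _) {IH f} => //= b cs IH v w.
by apply: integral_ge0 => x _; exact: IH.
Qed.

Lemma savg_ge0 cs F v w : (forall v, 0 <= F v) -> 0 <= savg cs F v w.
Proof.
move=> F0; elim: cs v w => //= a cs IH v w.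
by apply: integral_ge0 => x _; exact: IH.
Qed.

(* By induction: revealing [x], shifted by [k], turns the budget [u] into
   [u - (k x + k^2 / 2)]. *)
Lemma savg_le (l : R) cs F : (0 <= l)%R ->
  (forall v, 0 <= F v <= 1) -> measurable_fun setT F -> predictable cs ->
  forall rho u v w,
  (forall v', (forall c, c \notin cs -> v' c = v c) ->
     \sum_(a <- cs) h a v' ^+ 2 <= rho)%R ->
  savg cs F v w <= (expR u)%:E * avg cs F w +
                   (expR (l * (l + 1) / 2 * rho - l * u))%:E.
Proof.
move=> l0 F01 mF; have F0 v : 0 <= F v by case/andP: (F01 v).
elim: cs => [_ rho u v w hrho|a cs IH [ha hcs] rho u v w hrho] /=.
  have /andP[Fw0 Fw1] := F01 w.
  have {}hrho : (0 <= rho)%R by have := hrho v (fun _ _ => erefl); rewrite big_nil.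
  have c0 : (0 <= l * (l + 1) / 2 * rho)%R.
    by rewrite !mulr_ge0// addr_ge0.
  (* With no noise left, [F w] is below the first term if [u >= 0]; if [u <= 0] the exponent of the
     second term is nonnegative, and that term alone is at least 1. *)
  have [u0|/ltW u0] := leP 0%R u.
    apply: (@le_trans _ _ ((expR u)%:E * F w)); last first.
      by rewrite leeDl// lee_fin expR_ge0.
    by rewrite lee_pemull// lee_fin -expR0 ler_expR.
  apply: (le_trans Fw1); rewrite -[leLHS]add0e.
  apply: leeD; first by rewrite mule_ge0// lee_fin expR_ge0.
  rewrite lee_fin -[leLHS]expR0 ler_expR subr_ge0; apply: (le_trans _ c0).
  by rewrite mulr_ge0_le0.
set k := h a v.
pose G x := avg cs F (upd a x w).
have G0 x : 0 <= G x by exact: avg_ge0.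
have mG : measurable_fun [set: R] G by exact: measurable_avg_upd.
pose c := expR (l * (l + 1) / 2 * rho - l * u).
have mE b d : measurable_fun [set: R] (fun x : R => expR (b * x - d)).
  apply: (measurableT_comp (@measurable_expR R)).
  by apply: measurable_funB => //; exact: measurable_funM.
have mE' b d : measurable_fun [set: R] (fun x : R => expR (- (b * x) - d)).
  by under eq_fun do rewrite -mulNr; exact: mE.
(* The induction hypothesis is used with [rho - k ^+ 2] and [u - (k * x + k ^+ 2 / 2)]. Its first
   term then carries the Cameron-Martin factor of the shift [k]. In its second term the coefficient
   [l * (l + 1) / 2] leaves exactly the normalised exponential of parameter [l * k], of integral
   1. *)
apply: (@le_trans _ _ (\int[gamma]_x
    ((expR u)%:E * ((expR (- (k * x) - k ^+ 2 / 2))%:E * G (x + k)%R) +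
     c%:E * (expR (l * k * x - (l * k) ^+ 2 / 2))%:E))).
  apply: ge0_le_integral => //.
  - by move=> x _; exact: savg_ge0.
  - apply: (@measurableT_comp _ _ _ _ _ _ (fun z : V * V => savg cs F z.1 z.2) _
      (fun x : R => (upd a x v, upd a (x + k)%R w))).
      apply: measurable_savg => //.
    apply: measurable_fun_pair; apply: measurable_upd => //.
    exact: measurable_funD.
  - apply: emeasurable_funD; last first.
      apply: emeasurable_funM => //; apply/measurable_EFinP; exact: mE.
    apply: emeasurable_funM => //; apply: emeasurable_funM.
      apply/measurable_EFinP; exact: mE'.
    by apply: (measurableT_comp mG); exact: measurable_funD.
  move=> x _.
  have := IH hcs (rho - k ^+ 2)%R (u - (k * x + k ^+ 2 / 2))%R
    (upd a x v) (upd a (x + k)%R w).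
  rewrite -/(G _) muleA -!EFinM -!expRD.
  rewrite (_ : (u + (- (k * x) - k ^+ 2 / 2) =
    u - (k * x + k ^+ 2 / 2))%R); last by ring.
  rewrite (_ : (l * (l + 1) / 2 * rho - l * u + (l * k * x - (l * k) ^+ 2 / 2) =
    l * (l + 1) / 2 * (rho - k ^+ 2) - l * (u - (k * x + k ^+ 2 / 2)))%R);
    last by field.
  apply=> v' v'v; have agree b : b \notin a :: cs -> v' b = v b.
    rewrite inE negb_or => /andP[ba bcs].
    by rewrite v'v// /upd (negbTE ba).
  have := hrho v' agree; rewrite big_cons (ha v' v)// => H.
  by rewrite lerBrDl.
rewrite ge0_integralD//; last 4 first.
- by move=> x _; rewrite !mule_ge0// lee_fin expR_ge0.
- apply: emeasurable_funM => //; apply: emeasurable_funM.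
    apply/measurable_EFinP; exact: mE'.
  by apply: (measurableT_comp mG); exact: measurable_funD.
- by move=> x _; rewrite mule_ge0// lee_fin expR_ge0.
- by apply: emeasurable_funM => //; apply/measurable_EFinP; exact: mE.
rewrite !ge0_integralZl//; last 4 first.
- by apply/measurable_EFinP; exact: mE.
- by rewrite lee_fin expR_ge0.
- apply: emeasurable_funM; first by apply/measurable_EFinP; exact: mE'.
  by apply: (measurableT_comp mG); exact: measurable_funD.
- by move=> x _; rewrite mule_ge0// lee_fin expR_ge0.
by rewrite normal_prob_mgf mule1 normal_prob_shift.
Qed.

Lemma avg_shift_le (l rho u : R) cs F v : (0 <= l)%R ->
  (forall v, 0 <= F v <= 1) -> measurable_fun setT F -> predictable cs ->
  (forall v', \sum_(a <- cs) h a v' ^+ 2 <= rho)%R ->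
  avg cs (F \o shifted cs) v <= (expR u)%:E * avg cs F v +
                   (expR (l * (l + 1) / 2 * rho - l * u))%:E.
Proof.
move=> l0 F01 mF hp hrho; rewrite (@avg_shift [::] cs F v v hp).
  exact: savg_le.
by move=> b /negbTE bcs; rewrite /shifted bcs.
Qed.

End GaussianAverages.

(** * Replacing Gaussian coordinates by fresh ones *)

Section IndependentPair.
Context {R : realType} {disp d d' : measure_display}.
Context {W : measurableType disp} {P : probability W R}.
Context {U : measurableType d} {U' : measurableType d'}.
Local Open Scope ereal_scope.

(** The joint law is the product of the law of [X] and [nu] on rectangles, hence everywhere; Tonelli
    concludes. *)
Lemma integral_independent_pair (X : {RV P >-> U}) (Z : {RV P >-> U'})
    (nu : probability U' R) (H : U * U' -> \bar R) :
  (forall E B, measurable E -> measurable B ->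
     P (X @^-1` E `&` Z @^-1` B) = P (X @^-1` E) * nu B) ->
  (forall z, 0 <= H z) -> measurable_fun setT H ->
  \int[P]_om H (X om, Z om) = \int[P]_om \int[nu]_x H (X om, x).
Proof.
move=> XZ H0 mH.
have mY : measurable_fun setT (fun om => (X om, Z om)).
  exact: measurable_fun_pair.
pose Y : {RV P >-> (U * U')%type} := HB.pack (fun om => (X om, Z om))
  (isMeasurableFun.Build _ _ _ _ _ mY).
have YE S : measurable S -> (distribution P X \x nu) S = distribution P Y S.
  by apply: product_measure_unique => // E B mE mB; exact: XZ.
transitivity (\int[distribution P Y]_z H z).
  by rewrite ge0_integral_distribution.
transitivity (\int[distribution P X \x nu]_z H z).
  by apply: eq_measure_integral => S mS _; exact/esym/YE.
rewrite fubini_tonelli1// ge0_integral_distribution//.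
- exact: (measurable_fun_fubini_tonelli_F (m2 := nu)).
- by move=> v; exact: integral_ge0.
Qed.

End IndependentPair.

Section Resampling.
Context {R : realType} {A : eqType} {disp : measure_display}.
Context {W : measurableType disp} {P : probability W R}.
Local Notation gamma := (normal_prob (0 : R) 1).
Local Notation V := (@coords R A).
Variable X : W -> V.
Hypothesis mX : measurable_fun setT X.
Local Open Scope ereal_scope.

(** Setting coordinate [a] to 0 erases it, so [E] only sees the other coordinates. The identity
    expresses independence from them and, at [E = setT], the standard Gaussian law. *)
Definition fresh_gaussian (a : A) := forall (E : set V) (B : set R),
  measurable E -> measurable B ->
  P ((fun om => upd a 0%R (X om)) @^-1` E `&` (fun om => X om a) @^-1` B) =
  P ((fun om => upd a 0%R (X om)) @^-1` E) * gamma B.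

(** The vector is rebuilt by [upd] from its erased version and its coordinate [a], which form an
    independent pair. *)
Lemma resample (a : A) (G : V -> \bar R) : fresh_gaussian a ->
  (forall v, 0 <= G v) -> measurable_fun setT G ->
  \int[P]_om G (X om) = \int[P]_om \int[gamma]_x G (upd a x (X om)).
Proof.
move=> fa G0 mG.
have mX0 : measurable_fun setT (fun om => upd a 0%R (X om) : V).
  exact: measurable_upd.
have mXa : measurable_fun setT ((fun om => X om a) : W -> measurableTypeR R).
  exact: (measurableT_comp (measurable_coord a)).
pose X0 : {RV P >-> V} := HB.pack (fun om => upd a 0%R (X om) : V)
  (isMeasurableFun.Build _ _ _ _ _ mX0).
pose Xa : {RV P >-> measurableTypeR R} :=
  HB.pack ((fun om => X om a) : W -> measurableTypeR R)
  (isMeasurableFun.Build _ _ _ _ _ mXa).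
pose H (z : V * measurableTypeR R) := G (upd a z.2 z.1).
have H0 z : 0 <= H z by exact: G0.
have mH : measurable_fun setT H.
  by apply: (measurableT_comp mG); exact: measurable_upd.
have updd x v : upd a x (upd a 0%R v) = upd a x v.
  by apply/funext => b; rewrite /upd; case: eqP.
transitivity (\int[P]_om H (X0 om, Xa om)).
  apply: eq_integral => om _; rewrite /H /= updd; congr G.
  by apply/funext => b; rewrite /upd; case: eqP => // ->.
rewrite (@integral_independent_pair _ _ _ _ _ P _ _ X0 Xa gamma H fa H0 mH).
by apply: eq_integral => om _; apply: eq_integral => x _; rewrite /H /= updd.
Qed.

Lemma integral_avg (cs : seq A) (F : V -> \bar R) :
  (forall a, a \in cs -> fresh_gaussian a) ->
  (forall v, 0 <= F v) -> measurable_fun setT F ->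
  \int[P]_om F (X om) = \int[P]_om avg cs F (X om).
Proof.
move=> + F0 mF; elim: cs => //= a cs IH fcs.
rewrite IH; last by move=> b bcs; apply: fcs; rewrite inE bcs orbT.
apply: (resample (G := avg cs F)).
- by apply: fcs; rewrite mem_head.
- by move=> v; exact: avg_ge0.
- exact: measurable_avg.
Qed.

End Resampling.

(** * Measurability *)

Lemma continuous_addl (R : numFieldType) (U : normedModType R) (a : U) :
  continuous (fun x => a + x).
Proof. by move=> x; apply: cvgD; [exact: cvg_cst|exact: cvg_id]. Qed.

Section CaratheodoryFunctions.
Context {R : realType} {disp : measure_display} {W : measurableType disp}.

Definition measurable_entries (m n : nat) (u : W -> 'M[R]_(m, n)) :=
  forall i j, measurable_fun setT (fun om => u om i j).

(** The level sets of [k] cut the space into countably many measurable pieces, with a single [G i]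
    on each. *)
Lemma measurable_fun_countable (I : countType) (k : W -> I) (G : I -> W -> R) :
  (forall i, measurable (k @^-1` [set i])) ->
  (forall i, measurable_fun setT (G i)) ->
  measurable_fun setT (fun om => G (k om) om).
Proof.
move=> mk mG _ B mB; rewrite setTI.
rewrite (_ : _ @^-1` B = \bigcup_i (k @^-1` [set i] `&` G i @^-1` B)); last first.
  apply/seteqP; split => [om Bom|om [i _ [/= <-]]//]; by exists (k om).
apply: countable_bigcupT_measurable => [|i]; first exact: countableP.
by apply: measurableI => //; rewrite -[_ @^-1` B]setTI; exact: mG.
Qed.

Lemma measurable_preimage_pointwise (I : finType) (J : eqType) (T : eqType)
    (k : W -> T) (f : I -> W -> J) (t : T) (g : I -> J) :
  (forall om, k om = t <-> forall i, f i om = g i) ->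
  (forall i, measurable (f i @^-1` [set g i])) ->
  measurable (k @^-1` [set t]).
Proof.
move=> kf mf; rewrite (_ : _ @^-1` _ = \bigcap_i (f i @^-1` [set g i])).
  by apply: fin_bigcap_measurable => // i _; exact: mf.
apply/seteqP; split => om /=; first by move=> /kf + i _; exact.
by move=> H; apply/kf => i; exact: H.
Qed.

Variables (p : nat) (u : W -> 'rV[R]_p).
Hypothesis mu : measurable_entries u.

(** Followed by [point n], this rounds each coordinate down to a multiple of [1 / n.+1]; integer
    vectors are countable. *)
Let grid (n : nat) (th : 'rV[R]_p) : 'rV[int]_p :=
  \row_c Num.floor (n.+1%:R * th 0 c).

Let point (n : nat) (z : 'rV[int]_p) : 'rV[R]_p :=
  \row_c ((z 0 c)%:~R / n.+1%:R).

Let point_grid (th : 'rV[R]_p) : point n (grid n th) @[n --> \oo] --> th.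
Proof.
apply/cvg_ballP => e e0; have := @cvg_harmonic R.
move=> /cvgrPdist_lt/(_ _ e0); apply: filterS => n.
rewrite sub0r normrN ger0_norm ?invr_ge0// /harmonic => ne; split=> // i c.
rewrite /ball /= !mxE (ord1 i).
have n0 : (0 : R) < n.+1%:R by rewrite ltr0n.
have /andP[f1 f2] := floor_itv (n.+1%:R * th 0 c).
set f := (Num.floor _) in f1 f2 *.
apply: le_lt_trans ne; change (`|th 0 c - f%:~R / n.+1%:R| <= n.+1%:R^-1).
rewrite -{1}[th 0 c](mulKf (lt0r_neq0 n0)) mulrC -mulrBl normrM.
rewrite [X in _ * X]ger0_norm ?invr_ge0 ?(ltW n0)//.
apply: ler_piMl; rewrite ?invr_ge0 ?(ltW n0)// ger0_norm ?subr_ge0//.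
by rewrite lerBlDl ltW// (lt_le_trans f2)// intrD.
Qed.

(* Rounding [u] to a grid leaves countably many parameters, and continuity passes
   to the limit of fine grids. *)
Lemma measurable_caratheodory (F : 'rV[R]_p -> W -> R) :
  (forall om, continuous (F ^~ om)) -> (forall th, measurable_fun setT (F th)) ->
  measurable_fun setT (fun om => F (u om) om).
Proof.
move=> cF mF.
apply: (@measurable_fun_cvg _ _ _ _
  (fun n om => F (point n (grid n (u om))) om)) => [n|om _].
  apply: (@measurable_fun_countable _ (grid n \o u) (fun z => F (point n z))).
    move=> z; apply: (@measurable_preimage_pointwise 'I_p _ _ _
      (fun c om => Num.floor (n.+1%:R * u om 0 c)) _ (z 0)) => [om|c].
      split => [<- c|H]; first by rewrite /= mxE.
      by apply/rowP => c; rewrite /= mxE H.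
    rewrite (_ : _ @^-1` _ =
      (fun om => n.+1%:R * u om 0 c) @^-1` `[(z 0 c)%:~R, (z 0 c + 1)%:~R[).
      rewrite -[X in measurable X]setTI.
      by apply: measurable_funM => //; exact: mu.
    apply/seteqP; split => om /=; rewrite in_itv/=.
      by move=> <-; exact: floor_itv.
    by move=> H; apply/eqP; rewrite floor_eq.
  by move=> z; exact: mF.
apply: (cvg_comp _ (F ^~ om)); first exact: point_grid.
exact: cF.
Qed.

(** A partial derivative is the limit of difference quotients of step [n.+1%:R^-1], each measurable
    by [measurable_caratheodory]. *)
Lemma measurable_gradient (F : 'rV[R]_p -> W -> R) :
  (forall om th, differentiable (F ^~ om) th) ->
  (forall th, measurable_fun setT (F th)) ->
  measurable_entries (fun om => gradient (F ^~ om) (u om)).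
Proof.
move=> dF mF i c; rewrite (ord1 i).
pose e : 'rV[R]_p := delta_mx 0 c.
have cF om : continuous (F ^~ om).
  by move=> th; exact: differentiable_continuous.
apply: (@measurable_fun_cvg _ _ _ _
  (fun n om => n.+1%:R * (F (n.+1%:R^-1 *: e + u om) om - F (u om) om)))
  => [n|om _].
  apply: measurable_funM => //; apply: measurable_funB.
    apply: (measurable_caratheodory (F := fun th => F (n.+1%:R^-1 *: e + th))).
      move=> om th.
      apply: (@continuous_comp _ _ _ (fun th => n.+1%:R^-1 *: e + th) (F ^~ om)).
        exact: (@continuous_addl R 'rV[R]_p).
      exact: cF.
    by move=> th; exact: mF.
  exact: measurable_caratheodory.
rewrite mxE.
have de : derivable (F ^~ om) (u om) e by exact: diff_derivable.
have hn : (fun n : nat => n.+1%:R^-1 : R) n @[n --> \oo] --> (0 : R)^'.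
  move=> A [eps eps0 epsA]; have /cvgrPdist_lt/(_ _ eps0) := @cvg_harmonic R.
  apply: filterS => n ne; apply: epsA => //.
pose quot (h : R) := h^-1 *: ((F ^~ om \o shift (u om)) (h *: e) - F (u om) om).
have := cvg_comp _ quot hn de.
apply: cvg_trans; apply: near_eq_cvg; apply: nearW => n.
by rewrite /quot /= invrK.
Qed.

End CaratheodoryFunctions.

Section NoisyUpdateMeasurability.
Context {R : realType} {disp : measure_display} {W : measurableType disp}.
Variable p : nat.
Implicit Types u v z : W -> 'rV[R]_p.

Lemma measurable_clip (Om : R) v : measurable_entries v ->
  measurable_entries (fun om => clip Om (v om)).
Proof.
move=> mv i c; rewrite (ord1 i) /clip.
under eq_fun do rewrite mxE.
apply: measurable_funM; last exact: mv.
apply: (@measurableT_comp _ _ _ _ _ _ (fun x : R => (Num.max 1 (x / Om))^-1)).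
  apply: continuous_measurable_fun => x.
  apply: cvgV; first by rewrite gt_eqF// lt_max ltr01.
  have cx : (fun x : R => x / Om) x @[x --> x] --> x / Om.
    by apply: cvgM; [exact: cvg_id|exact: cvg_cst].
  under eq_cvg do rewrite maxr_absE.
  rewrite maxr_absE; apply: cvgM; last exact: cvg_cst.
  apply: cvgD; first by apply: cvgD => //; exact: cvg_cst.
  by apply: cvg_norm; apply: cvgB => //; exact: cvg_cst.
apply: (@measurableT_comp _ _ _ _ _ _ (@Num.sqrt R)).
  by apply: continuous_measurable_fun; exact: sqrt_continuous.
apply: measurable_sum => j; apply: measurable_funX; exact: mv.
Qed.

Lemma measurable_noisy_update (Om sigma eta : R) v z u :
  measurable_entries v -> measurable_entries z -> measurable_entries u ->
  measurable_entries (fun om => noisy_update Om sigma eta (v om) (z om) (u om)).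
Proof.
move=> mv mz mu i c; rewrite /noisy_update.
under eq_fun do rewrite 3!mxE.
apply: measurable_funB; first exact: mu.
apply: measurable_funM => //.
under eq_fun do rewrite mxE [X in _ + X]mxE.
apply: measurable_funD; first exact: measurable_clip.
by apply: measurable_funM => //; exact: mz.
Qed.

Lemma measurable_train (step : W -> nat -> 'rV[R]_p -> 'rV[R]_p) th0 t :
  (forall t u, measurable_entries u ->
     measurable_entries (fun om => step om t (u om))) ->
  measurable_entries (fun om => train (step om) th0 t).
Proof.
move=> mstep; elim: t => [|t IH] /=; last exact: mstep.
by move=> i c; exact: measurable_cst.
Qed.

End NoisyUpdateMeasurability.

Section SquaredLoss.
Context {R : realType}.
Variables (m q : nat) (c : R).

(** Removes the square root, which is not differentiable at 0, from the losses. *)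
Lemma frobenius_sqr (n p : nat) (A : 'M[R]_(n, p)) :
  frobenius A ^+ 2 = \sum_i \sum_j A i j ^+ 2.
Proof.
rewrite sqr_sqrtr// sumr_ge0// => i _; rewrite sumr_ge0// => j _.
exact: sqr_ge0.
Qed.

Lemma differentiable_squared_loss (p : nat) (f : 'I_m -> 'rV[R]_p -> 'rV[R]_q)
    (y : 'M[R]_(m, q)) (th : 'rV[R]_p) :
  (forall a, differentiable (f a) th) ->
  differentiable (fun th => c * frobenius ((\matrix_a f a th) - y) ^+ 2) th.
Proof.
move=> df.
rewrite (_ : (fun th => _) = cst c * \sum_(i < m) \sum_(j < q)
    (fun th => f i th 0 j - y i j) ^+ 2); last first.
  apply/funext => x; rewrite frobenius_sqr fctE; congr (_ * _).
  rewrite fct_sumE; apply: eq_bigr => i _; rewrite fct_sumE.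
  by apply: eq_bigr => j _; rewrite !mxE exprfctE.
apply: differentiableM; first exact: differentiable_cst.
apply: differentiable_sum => i; apply: differentiable_sum => j.
apply: differentiableX; apply: differentiableB; last exact: differentiable_cst.
apply: (@differentiable_comp _ _ _ _ (f i) (fun M : 'rV[R]_q => M 0 j)) => //.
exact: differentiable_coord.
Qed.

Lemma measurable_squared_loss (disp : measure_display) (W : measurableType disp)
    (f : 'I_m -> W -> 'rV[R]_q) (y : W -> 'M[R]_(m, q)) :
  (forall a, measurable_entries (f a)) -> measurable_entries y ->
  measurable_fun setT
    (fun om => c * frobenius ((\matrix_a f a om) - y om) ^+ 2).
Proof.
move=> mf my; apply: measurable_funM => //.
under eq_fun do rewrite frobenius_sqr.
apply: measurable_sum => i; apply: measurable_sum => j; apply: measurable_funX.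
under eq_fun do rewrite !mxE.
by apply: measurable_funB; [exact: mf|exact: my].
Qed.

End SquaredLoss.

Section Runs.
Variables (R : realType) (g : nat) (s : setup R g).

(** [guest_final] with the number of epochs left free, for inductions over epochs. *)
Definition guest_run (sigma : R) (D : dataset s) (r : seed s) (j : 'I_g)
    (t : nat) : 'rV[R]_(pdim s j) :=
  train (fun t th =>
           noisy_update (clipping s) sigma (rate s t)
             (guest_gradient (targets r j) (batch D r (lift ord0 j) t) th)
             (noise _ r (lift ord0 j) t) th)
        (ginit s j) t.

(** The representations are an argument, so that the host can be studied for given ones. *)
Definition host_run (sigma : R) (D : dataset s) (r : seed s)
    (rep : sample s -> 'M[R]_(g, rdim s)) (t : nat) : 'rV[R]_(wdim s) :=
  train (fun t w =>
           noisy_update (clipping s) sigma (rate s t)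
             (gradient (host_loss rep (batch D r ord0 t)) w)
             (noise _ r ord0 t) w)
        (winit s) t.

Lemma guest_runS sigma D r j t : guest_run sigma D r j t.+1 =
  noisy_update (clipping s) sigma (rate s t)
    (guest_gradient (targets r j) (batch D r (lift ord0 j) t)
       (guest_run sigma D r j t))
    (noise _ r (lift ord0 j) t) (guest_run sigma D r j t).
Proof. by []. Qed.

Lemma host_runS sigma D r rep t : host_run sigma D r rep t.+1 =
  noisy_update (clipping s) sigma (rate s t)
    (gradient (host_loss rep (batch D r ord0 t)) (host_run sigma D r rep t))
    (noise _ r ord0 t) (host_run sigma D r rep t).
Proof. by []. Qed.

End Runs.

(** * Measurability of the training algorithm *)

Section FedOnceMeasurability.
Context {R : realType} {g : nat} {s : setup R g}.
Context {disp : measure_display} {W : measurableType disp}.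
Variable r : W -> seed s.
Hypothesis adm : admissible s.
Hypothesis mtargets : forall j i,
  measurable_entries (fun om => targets (r om) j i).
Hypothesis mbits : forall k t i,
  measurable_fun setT (fun om => bits (r om) k t i).
Hypothesis mnoises : forall k t c,
  measurable_fun setT (fun om => noises (r om) k t c).

Lemma measurable_guest_loss (j : 'I_g) (J : seq (nat * sample s)) pi
    (th : 'rV[R]_(pdim s j)) :
  measurable_fun setT (fun om => @guest_loss R g s j (targets (r om) j) J pi th).
Proof.
apply: measurable_squared_loss => [a i c|i c]; first exact: measurable_cst.
by under eq_fun do rewrite -row_permE !mxE; exact: mtargets.
Qed.

Lemma differentiable_guest_loss (j : 'I_g) C (J : seq (nat * sample s)) pi
    (th : 'rV[R]_(pdim s j)) :
  differentiable (@guest_loss R g s j C J pi) th.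
Proof. by apply: differentiable_squared_loss => a; case: adm. Qed.

(** The chosen permutation depends on the randomness only through the finite table of comparisons
    between losses. On each level set of the table it is constant, whatever the tie rule, and the
    gradient of a fixed loss remains. *)
Lemma measurable_guest_gradient (j : 'I_g) (J : seq (nat * sample s))
    (u : W -> 'rV[R]_(pdim s j)) : measurable_entries u ->
  measurable_entries (fun om => guest_gradient (targets (r om) j) J (u om)).
Proof.
move=> mu i c.
pose loss om pi := @guest_loss R g s j (targets (r om) j) J pi.
pose best (t : {ffun 'S_(size J) * 'S_(size J) -> bool}) :=
  tie s [set pi | [forall pi', t (pi, pi')]]%SET.
pose table om := [ffun pp => loss om pp.1 (u om) <= loss om pp.2 (u om)].
have bestE om : @assignment R g s j (targets (r om) j) J (u om) = best (table om).
  rewrite /assignment /best; congr (tie s _); apply/setP => pi.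
  by rewrite !inE; apply: eq_forallb => pi'; rewrite ffunE.
under eq_fun do rewrite /guest_gradient bestE.
apply: (@measurable_fun_countable _ _ _ _ table
  (fun t om => gradient (loss om (best t)) (u om) i c)) => t.
  apply: (@measurable_preimage_pointwise _ _ _ _ _ table
    (fun pp om => loss om pp.1 (u om) <= loss om pp.2 (u om)) t t) => [om|pp].
    split => [<- pp|H]; first by rewrite ffunE.
    by apply/ffunP => pp; rewrite ffunE H.
  have mloss pi : measurable_fun setT (fun om => loss om pi (u om)).
    apply: (measurable_caratheodory mu (F := fun th om => loss om pi th))
      => [om th|th]; last exact: measurable_guest_loss.
    by apply: differentiable_continuous; exact: differentiable_guest_loss.
  by rewrite -[X in measurable X]setTI; exact: measurable_fun_ler.
apply: (measurable_gradient mu (F := fun th om => loss om (best t) th))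
  => [om th|th].
  exact: differentiable_guest_loss.
exact: measurable_guest_loss.
Qed.

(** A batch is the list of records filtered by a boolean mask, and there are countably many
    masks. *)
Lemma measurable_on_batch (D : dataset s) k t
    (G : seq (nat * sample s) -> W -> R) :
  (forall J, measurable_fun setT (G J)) ->
  measurable_fun setT (fun om => G (batch D (r om) k t) om).
Proof.
move=> mG.
pose sel (l : seq (nat * sample s)) om := [seq bits (r om) k t e.1 | e <- l].
have -> : (fun om => G (batch D (r om) k t) om) =
    (fun om => G (mask (sel (records D) om) (records D)) om).
  by apply/funext => om; rewrite /batch filter_mask.
apply: (@measurable_fun_countable _ _ _ _ (sel (records D))
  (fun b => G (mask b (records D)))) => // b.
elim: (records D) b => [|e l IH] [|b0 b].
- by rewrite (_ : _ @^-1` _ = setT)//; apply/seteqP; split.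
- by rewrite (_ : _ @^-1` _ = set0)//; apply/seteqP; split.
- by rewrite (_ : _ @^-1` _ = set0)//; apply/seteqP; split.
rewrite (_ : _ @^-1` _ = (fun om => bits (r om) k t e.1) @^-1` [set b0] `&`
    sel l @^-1` [set b]); last first.
  by apply/seteqP; split => om /= => [[-> ->]|[-> ->]].
apply: measurableI => //; rewrite -[X in measurable X]setTI.
exact: mbits.
Qed.

Lemma measurable_noise (p : nat) k t :
  measurable_entries (fun om => noise p (r om) k t).
Proof. by move=> i c; under eq_fun do rewrite mxE; exact: mnoises. Qed.

Lemma measurable_guest_batch_gradient (D : dataset s) (j : 'I_g) k t
    (u : W -> 'rV[R]_(pdim s j)) : measurable_entries u ->
  measurable_entries (fun om =>
    guest_gradient (targets (r om) j) (batch D (r om) k t) (u om)).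
Proof.
move=> mu i c; apply: (measurable_on_batch D k t
  (G := fun J om => guest_gradient (targets (r om) j) J (u om) i c)) => J.
exact: measurable_guest_gradient.
Qed.

Lemma measurable_guest_run sigma (D : dataset s) (j : 'I_g) t :
  measurable_entries (fun om => guest_run sigma D (r om) j t).
Proof.
apply: measurable_train => {}t u mu; apply: measurable_noisy_update => //.
- exact: measurable_guest_batch_gradient.
- exact: measurable_noise.
Qed.

Lemma measurable_representation (T : 'I_g.+1 -> nat) sigma (D : dataset s)
    (x : sample s) :
  measurable_entries (fun om => representation T sigma D (r om) x).
Proof.
move=> j c; under eq_fun do rewrite mxE.
have mfinal : measurable_entries (fun om => guest_final T sigma D (r om) j).
  exact: measurable_guest_run.
apply: (measurable_caratheodory mfinal
  (F := fun th _ => gmodel th (gx x j) 0 c)) => [om th|th].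
  apply: differentiable_continuous.
  apply: (@differentiable_comp _ _ _ _ (fun th => gmodel th (gx x j))
    (fun M : 'rV[R]_(rdim s) => M 0 c)); first by case: adm.
  exact: differentiable_coord.
exact: measurable_cst.
Qed.

Lemma measurable_host_batch_gradient (D : dataset s) k t
    (rep : W -> sample s -> 'M[R]_(g, rdim s)) (u : W -> 'rV[R]_(wdim s)) :
  (forall x, measurable_entries (rep ^~ x)) -> measurable_entries u ->
  measurable_entries (fun om =>
    gradient (host_loss (rep om) (batch D (r om) k t)) (u om)).
Proof.
case: adm => _ _ _ _ [dmodel mmodel] mrep mu i c.
apply: (measurable_on_batch D k t
  (G := fun J om => gradient (host_loss (rep om) J) (u om) i c)) => J.
apply: (measurable_gradient mu (F := fun w om => host_loss (rep om) J w))
  => [om w|w].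
  exact: differentiable_squared_loss.
apply: measurable_squared_loss => [a i' b|i' b]; last exact: measurable_cst.
move=> _ B mB; rewrite setTI (ord1 i').
apply: (sigma_of_preimage (f := rep ^~ _) _ (mmodel _ w b B mB)).
by move=> [i1 j1]; exact: mrep.
Qed.

Lemma measurable_host_run sigma (D : dataset s)
    (rep : W -> sample s -> 'M[R]_(g, rdim s)) t :
  (forall x, measurable_entries (rep ^~ x)) ->
  measurable_entries (fun om => host_run sigma D (r om) (rep om) t).
Proof.
move=> mrep; apply: measurable_train => {}t u mu.
apply: measurable_noisy_update => //.
- exact: measurable_host_batch_gradient.
- exact: measurable_noise.
Qed.

Lemma measurable_fedonce (T : 'I_g.+1 -> nat) sigma (D : dataset s)
    (S : set (output s)) : output_events S ->
  measurable [set om | S (fedonce T sigma D (r om))].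
Proof.
apply: (sigma_of_preimage (f := fun om => fedonce T sigma D (r om))).
have mguest j : measurable_entries (fun om => guest_final T sigma D (r om) j).
  exact: measurable_guest_run.
have mhost : measurable_entries (fun om => host_final T sigma D (r om)).
  apply: (measurable_host_run sigma D (T ord0)) => x.
  exact: measurable_representation.
by move=> [[j c]|c]; [exact: mguest|exact: mhost].
Qed.

End FedOnceMeasurability.

(** * The noise shift between two datasets *)

Section Shift.
Context {R : realType}.

(** Noise enters multiplied by [sigma * Om]; after this division the shift cancels the difference of
    the clipped gradients exactly. *)
Lemma noisy_update_shift (p : nat) (Om sigma eta : R) (v v' z z' th : 'rV[R]_p) :
  sigma * Om != 0 ->
  (forall c, z' 0 c = z 0 c + (clip Om v 0 c - clip Om v' 0 c) / (sigma * Om)) ->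
  noisy_update Om sigma eta v' z' th = noisy_update Om sigma eta v z th.
Proof.
rewrite /noisy_update; move: (clip Om v) (clip Om v') => a b sOm zz'.
congr (_ - _ *: _); apply/rowP => c; rewrite !mxE zz'.
by rewrite mulrDr [X in _ + (_ + X)]mulrCA divff// mulr1; ring.
Qed.

Lemma norm2_sqr (p : nat) (v : 'rV[R]_p) : norm2 v ^+ 2 = \sum_i v 0 i ^+ 2.
Proof. by rewrite sqr_sqrtr// sumr_ge0// => i _; rewrite sqr_ge0. Qed.

Lemma clip_bound (p : nat) (Om : R) (v : 'rV[R]_p) : 0 < Om ->
  \sum_i clip Om v 0 i ^+ 2 <= Om ^+ 2.
Proof.
move=> Om0; rewrite /clip; set m := Num.max _ _.
have m0 : 0 < m by rewrite lt_max ltr01.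
have Nm : norm2 v <= m * Om by rewrite -ler_pdivrMr// le_max lexx orbT.
under eq_bigr do rewrite mxE exprMn.
rewrite -mulr_sumr -norm2_sqr -exprMn ler_sqr ?nnegrE ?(ltW Om0)//.
  by rewrite mulrC ler_pdivrMr// mulrC.
by rewrite mulr_ge0 ?sqrtr_ge0// invr_ge0 ltW.
Qed.

(** In the sorted list nothing from [a] on has smaller rank than [a], so the coordinates that [h a]
    may read come earlier or lie outside the list. Ties are harmless: [h a] reads strictly smaller
    ranks only. *)
Lemma predictable_sorted (A : eqType) (h : A -> @coords R A -> R)
    (rk : A -> nat) (cs : seq A) :
  (forall a v v', (forall c, (rk c < rk a)%N -> v c = v' c) -> h a v = h a v') ->
  predictable h (sort (relpre rk leq) cs).
Proof.
move=> hrk.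
have tot : total (relpre rk leq) by move=> a b; exact: leq_total.
have tr : transitive (relpre rk leq) by move=> a b c /=; exact: leq_trans.
have := sort_sorted tot cs; elim: (sort _ _) => //= a l IH al; split; last first.
  by apply: IH; exact: path_sorted al.
move=> v v' vv'; apply: hrk => c ca; apply: vv'; rewrite inE negb_or.
apply/andP; split; first by apply: contraTneq ca => ->; rewrite ltnn.
apply: contraL ca => cl; rewrite -leqNgt.
by have /allP/(_ _ cl) := order_path_min tr al.
Qed.

(** Indexing by [nat], with default 0, matches [noises], which serves parties of different
    dimensions. *)
Definition entry (p : nat) (u : 'rV[R]_p) (c : nat) : R :=
  if insub c is Some c' then u 0 c' else 0.

Lemma entry_ord (p : nat) (u : 'rV[R]_p) (c : 'I_p) : entry u c = u 0 c.
Proof. by rewrite /entry valK. Qed.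

Lemma measurable_entry (disp : measure_display) (W : measurableType disp)
    (p : nat) (u : W -> 'rV[R]_p) (c : nat) : measurable_entries u ->
  measurable_fun setT (fun om => entry (u om) c).
Proof. by move=> mu; rewrite /entry; case: insubP => [c' _ _|_]; [exact: mu|]. Qed.

End Shift.

Section FedOnceShift.
Variables (R : realType) (g : nat) (s : setup R g).
Local Notation d := (rdim s).
Local Notation Om := (clipping s).

Definition seed_coord : Type :=
  ('I_g * nat * 'I_d + 'I_g.+1 * nat * nat + 'I_g.+1 * nat * nat)%type.

(** All randomness becomes one real vector. A bit is read by testing its coordinate against 1, so
    every vector decodes to a seed. *)
Definition seed_of (v : seed_coord -> R) : seed s :=
  Seed (fun j i => \row_c v (inl (inl (j, i, c))))
       (fun k t i => v (inl (inr (k, t, i))) == 1)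
       (fun k t c => v (inr (k, t, c))).

Lemma measurable_seed_targets j i :
  measurable_entries (fun v : @coords R seed_coord => targets (seed_of v) j i).
Proof.
move=> a c; rewrite (_ : (fun v => _) =
    fun v : @coords R seed_coord => v (inl (inl (j, i, c)))).
  exact: measurable_coord.
by apply/funext => v; rewrite mxE.
Qed.

Lemma measurable_seed_bits k t i :
  measurable_fun setT (fun v : @coords R seed_coord => bits (seed_of v) k t i).
Proof.
apply: (measurable_fun_bool true); rewrite setTI /=.
rewrite (_ : _ @^-1` _ =
  (fun v : @coords R seed_coord => v (inl (inr (k, t, i)))) @^-1` [set 1]).
  rewrite -[X in measurable X]setTI.
  by apply: measurable_coord => //; exact: measurable_set1.
by apply/seteqP; split => v /eqP.
Qed.

Lemma measurable_seed_noises k t c :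
  measurable_fun setT (fun v : @coords R seed_coord => noises (seed_of v) k t c).
Proof. exact: measurable_coord. Qed.

Variables (T : 'I_g.+1 -> nat) (sigma : R).
Implicit Types (D E : dataset s) (r : seed s).

Definition width (k : 'I_g.+1) : nat :=
  if unlift ord0 k is Some j then pdim s j else wdim s.

(* The clipped gradient that party [k] would compute at epoch [t] from the data
   [E], at the parameters reached by the run on [D]. *)
Definition clipped_gradient D E r (k : 'I_g.+1) (t : nat) : nat -> R :=
  if unlift ord0 k is Some j then
    entry (clip Om (guest_gradient (targets r j) (batch E r (lift ord0 j) t)
                      (guest_run sigma D r j t)))
  else
    entry (clip Om (gradient (host_loss (representation T sigma D r)
                                        (batch E r ord0 t))
                      (host_run sigma D r (representation T sigma D r) t))).

(** The extra noise with which the run on [E] follows the run on [D]. Both gradients are taken along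
    the run on [D], so this is a function of the unshifted noise. *)
Definition noise_shift D E (a : seed_coord) (v : @coords R seed_coord) : R :=
  if a is inr (k, t, c) then
    (clipped_gradient D D (seed_of v) k t c -
     clipped_gradient D E (seed_of v) k t c) / (sigma * Om)
  else 0.

(* All guest noise precedes the host's, whose gradients depend on it. *)
Definition time (a : seed_coord) : nat :=
  if a is inr (k, t, _) then
    if unlift ord0 k is Some _ then t.+1 else (\sum_k T k + t).+1
  else 0.

Definition noise_coords : seq seed_coord := sort (relpre time leq)
  [seq inr tc | tc <- flatten
     [seq [seq (k, t, c) | t <- iota 0 (T k), c <- iota 0 (width k)]
     | k <- enum 'I_g.+1]].

Lemma mem_noise_coords k t c :
  (t < T k)%N -> (c < width k)%N -> inr (k, t, c) \in noise_coords.
Proof.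
move=> tT cw; rewrite mem_sort; apply/mapP; exists (k, t, c) => //.
apply/flattenP; exists [seq (k, t, c) | t <- iota 0 (T k), c <- iota 0 (width k)].
  by apply/mapP; exists k; rewrite ?mem_enum.
by apply/allpairsP; exists (t, c); rewrite !mem_iota.
Qed.

Lemma noise_coords_inl a : inl a \notin noise_coords.
Proof. by rewrite mem_sort; apply/mapP => -[]. Qed.

Lemma sum_noise_coords (F : seed_coord -> R) :
  \sum_(a <- noise_coords) F a =
  \sum_k \sum_(t < T k) \sum_(c < width k) F (inr (k, t : nat, c : nat)).
Proof.
rewrite (perm_big _ (permEl (perm_sort _ _)))/= big_map big_flatten/= big_map.
rewrite big_enum/=; apply: eq_bigr => k _; rewrite big_allpairs_dep.
have iotaE n : iota 0 n = index_iota 0 n by rewrite /index_iota subn0.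
by rewrite iotaE big_mkord; apply: eq_bigr => t _; rewrite iotaE big_mkord.
Qed.

Hypothesis adm : admissible s.
Hypothesis sigma_gt0 : 0 < sigma.

Let Om_gt0 : 0 < Om. Proof. by case: adm. Qed.

Lemma sum_clipped_gradient D E r k t :
  \sum_(c < width k) clipped_gradient D E r k t c ^+ 2 <= Om ^+ 2.
Proof.
rewrite /width /clipped_gradient; case: (unlift ord0 k) => [j|].
- by under eq_bigr do rewrite entry_ord; exact: clip_bound.
- by under eq_bigr do rewrite entry_ord; exact: clip_bound.
Qed.

Lemma sum_noise_shift D E v :
  \sum_(a <- noise_coords) noise_shift D E a v ^+ 2 <=
  4 * (\sum_k T k)%:R / sigma ^+ 2.
Proof.
rewrite sum_noise_coords natr_sum mulr_sumr mulr_suml; apply: ler_sum => k _.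
rewrite (_ : 4 * _ / _ = \sum_(t < T k) 4 / sigma ^+ 2); last first.
  by rewrite sumr_const card_ord -mulr_natr; ring.
apply: ler_sum => t _ /=.
set u := clipped_gradient D D _ k t; set w := clipped_gradient D E _ k t.
have sOm : 0 < (sigma * Om) ^+ 2 by rewrite exprn_gt0// mulr_gt0.
(* Prepares [(x - y)^2 <= 2 (x^2 + y^2)] with both clipped gradients of squared norm at most
   [Om ^+ 2]. *)
rewrite (_ : 4 / _ = (2 * (Om ^+ 2 + Om ^+ 2)) / (sigma * Om) ^+ 2); last first.
  by field; rewrite !gt_eqF.
rewrite ler_pdivlMr// mulr_suml.
apply: (@le_trans _ _ (\sum_(c < width k) 2 * (u c ^+ 2 + w c ^+ 2))).
  apply: ler_sum => c _; rewrite -exprMn divfK ?mulf_neq0 ?gt_eqF//.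
  rewrite -subr_ge0 (_ : _ - _ = (u c + w c) ^+ 2); last by ring.
  exact: sqr_ge0.
rewrite -mulr_sumr ler_pM2l// big_split/=.
by rewrite lerD// sum_clipped_gradient.
Qed.

(** The space of noise vectors itself serves as sample space, with [seed_of] as the random seed. *)
Lemma measurable_noise_shift D E a : measurable_fun setT (noise_shift D E a).
Proof.
case: a => [a|[[k t] c]]; first exact: measurable_cst.
have mt := measurable_seed_targets; have mb := measurable_seed_bits.
have mn := measurable_seed_noises.
have mg E' : measurable_fun setT (fun v : @coords R seed_coord =>
    clipped_gradient D E' (seed_of v) k t c).
  rewrite /clipped_gradient; case: (unlift ord0 k) => [j|].
    apply: measurable_entry; apply: measurable_clip.
    apply: measurable_guest_batch_gradient => //.
    exact: measurable_guest_run.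
  apply: measurable_entry; apply: measurable_clip.
  apply: measurable_host_batch_gradient => //.
    by move=> x; exact: measurable_representation.
  apply: measurable_host_run => // x; exact: measurable_representation.
by apply: measurable_funM => //; apply: measurable_funB.
Qed.

Lemma eq_batch D r r' k t :
  bits r k t = bits r' k t -> batch D r k t = batch D r' k t.
Proof. by rewrite /batch => ->. Qed.

Lemma eq_noise p r r' k t :
  noises r k t = noises r' k t -> noise p r k t = noise p r' k t.
Proof. by rewrite /noise => ->. Qed.

Lemma eq_guest_run D r r' j t : targets r j = targets r' j ->
  bits r (lift ord0 j) = bits r' (lift ord0 j) ->
  (forall t', (t' < t)%N ->
     noises r (lift ord0 j) t' = noises r' (lift ord0 j) t') ->
  guest_run sigma D r j t = guest_run sigma D r' j t.
Proof.
move=> et eb; elim: t => [//|t IH] en.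
rewrite !guest_runS IH; last first.
  by move=> t' t't; apply: en; exact: ltnW.
rewrite et (@eq_batch D r r'); last by rewrite eb.
by rewrite (@eq_noise _ r r') ?en.
Qed.

Lemma eq_host_run D r r' rep t : bits r ord0 = bits r' ord0 ->
  (forall t', (t' < t)%N -> noises r ord0 t' = noises r' ord0 t') ->
  host_run sigma D r rep t = host_run sigma D r' rep t.
Proof.
move=> eb; elim: t => [//|t IH] en.
rewrite !host_runS IH; last first.
  by move=> t' t't; apply: en; exact: ltnW.
rewrite (@eq_batch D r r'); last by rewrite eb.
by rewrite (@eq_noise _ r r') ?en.
Qed.

Lemma predictable_noise_shift D E : predictable (noise_shift D E) noise_coords.
Proof.
apply: predictable_sorted => -[//|[[k t] c]] v v' vv'.
(* Targets and bits have time 0 and noise has time at least 1, so every shift may read them. *)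
have et : targets (seed_of v) = targets (seed_of v').
  apply/funext => j; apply/funext => i; apply/rowP => b; rewrite !mxE; apply: vv'.
  by rewrite /time; case: unlift.
have eb : bits (seed_of v) = bits (seed_of v').
  apply/funext => k'; apply/funext => t'; apply/funext => i; rewrite /= vv'//.
  by rewrite /time; case: unlift.
rewrite /noise_shift /clipped_gradient; case: unliftP vv' => [j ->|->] vv'.
  have en t' : (t' < t)%N ->
      noises (seed_of v) (lift ord0 j) t' = noises (seed_of v') (lift ord0 j) t'.
    by move=> t't; apply/funext => b; apply: vv'; rewrite /time liftK.
  have -> : guest_run sigma D (seed_of v) j t = guest_run sigma D (seed_of v') j t.
    by apply: eq_guest_run; rewrite ?et ?eb.
  have bE E' : batch E' (seed_of v) (lift ord0 j) t =
      batch E' (seed_of v') (lift ord0 j) t.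
    by apply: eq_batch; rewrite eb.
  by rewrite et !bE.
have en t' : (t' < t)%N -> noises (seed_of v) ord0 t' = noises (seed_of v') ord0 t'.
  move=> t't; apply/funext => b; apply: vv'.
  by rewrite /time unlift_none ltnS ltn_add2l.
have er : representation T sigma D (seed_of v) =
    representation T sigma D (seed_of v').
  apply/funext => x; apply/matrixP => j b; rewrite !mxE.
  rewrite -![guest_final _ _ _ _ _]/(guest_run _ _ _ _ _).
  congr (gmodel _ _ _ _); apply: eq_guest_run; rewrite ?et ?eb// => t' t't.
  (* The offset [\sum_k T k] in the host's time exceeds every guest epoch used by the
     representations. *)
  apply/funext => b'; apply: vv'; rewrite /time liftK unlift_none ltnS.
  apply: (leq_trans t't); apply: leq_trans (leq_addr _ _).
  by rewrite (bigD1 (lift ord0 j))//= leq_addr.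
have bE E' : batch E' (seed_of v) ord0 t = batch E' (seed_of v') ord0 t.
  by apply: eq_batch; rewrite eb.
have hE rep : host_run sigma D (seed_of v) rep t =
    host_run sigma D (seed_of v') rep t.
  by apply: eq_host_run; rewrite ?eb.
by rewrite er hE !bE.
Qed.

(** By induction on epochs both runs are at the same parameters, so [noisy_update_shift] applies.
    The guests come first; their equal representations then allow the same induction for the
    host. *)
Lemma fedonce_shift D E v :
  fedonce T sigma E (seed_of (shifted (noise_shift D E) noise_coords v)) =
  fedonce T sigma D (seed_of v).
Proof.
set v' := shifted _ _ v.
have et : targets (seed_of v') = targets (seed_of v).
  apply/funext => j; apply/funext => i; apply/rowP => b.
  by rewrite !mxE /v' /shifted (negbTE (noise_coords_inl _)).
have eb : bits (seed_of v') = bits (seed_of v).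
  apply/funext => k; apply/funext => t; apply/funext => i.
  by rewrite /= /v' /shifted (negbTE (noise_coords_inl _)).
have en k t c : (t < T k)%N -> (c < width k)%N ->
    noises (seed_of v') k t c = noises (seed_of v) k t c +
    (clipped_gradient D D (seed_of v) k t c -
     clipped_gradient D E (seed_of v) k t c) / (sigma * Om).
  by move=> tT cw; rewrite /= /v' /shifted mem_noise_coords.
have sOm : sigma * Om != 0 by rewrite mulf_neq0 ?gt_eqF.
have guestE j t : (t <= T (lift ord0 j))%N ->
    guest_run sigma E (seed_of v') j t = guest_run sigma D (seed_of v) j t.
  elim: t => [//|t IH] tT.
  rewrite !guest_runS IH ?(ltnW tT)// et.
  have -> k : batch E (seed_of v') k t = batch E (seed_of v) k t.
    by apply: eq_batch; rewrite eb.
  apply: noisy_update_shift => // c; rewrite [LHS]mxE [in RHS]mxE en//; last first.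
    by rewrite /width liftK.
  by rewrite /clipped_gradient liftK !entry_ord.
have repE : representation T sigma E (seed_of v') =
    representation T sigma D (seed_of v).
  apply/funext => x; apply/matrixP => j b; rewrite !mxE.
  by rewrite -![guest_final _ _ _ _ _]/(guest_run _ _ _ _ _) guestE.
have hostE t : (t <= T ord0)%N ->
    host_run sigma E (seed_of v') (representation T sigma D (seed_of v)) t =
    host_run sigma D (seed_of v) (representation T sigma D (seed_of v)) t.
  elim: t => [//|t IH] tT.
  rewrite !host_runS IH ?(ltnW tT)//.
  have -> k : batch E (seed_of v') k t = batch E (seed_of v) k t.
    by apply: eq_batch; rewrite eb.
  apply: noisy_update_shift => // c; rewrite [LHS]mxE [in RHS]mxE en//; last first.
    by rewrite /width unlift_none.
  by rewrite /clipped_gradient unlift_none !entry_ord.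
rewrite /fedonce; congr pair.
  by apply: functional_extensionality_dep => j; exact: guestE.
rewrite -[LHS]/(host_run _ _ _ _ _) -[RHS]/(host_run _ _ _ _ _) repE.
exact: hostE.
Qed.

End FedOnceShift.

(** * Independence of the sources of randomness *)

Section SigmaAlgebras.
Context {T : Type} {G : set_system T}.
Hypothesis sG : sigma_algebra setT G.

Lemma sigma_algebra_setT : G setT.
Proof. by case: sG => G0 GC _; rewrite -(setD0 setT); exact: GC. Qed.

Lemma sigma_algebra_setI : setI_closed G.
Proof.
case: sG => G0 GC GU A B GA GB.
rewrite -(setCK (A `&` B)) setCI -setTD; apply: (GC).
rewrite -bigcup2E; apply: GU => -[|[|n]] /=; rewrite -?setTD; [exact: GC|exact: GC|].
exact: G0.
Qed.

End SigmaAlgebras.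

Section Independence.
Context {R : realType} {disp : measure_display} {W : measurableType disp}.
Context {P : probability W R} {I : choiceType} {F : I -> set_system W}.
Hypothesis sF : forall i, sigma_algebra setT (F i).
Hypothesis mF : forall i, F i `<=` measurable.
Hypothesis indF : mutually_independent P F.

(** The pi-system of events that constrain finitely many sources, [i0] not among them. Taking
    [E i = setT] off [A] lets intersections be formed source by source. *)
Definition cylinders (i0 : I) : set_system W :=
  [set C | exists (A : {fset I}) (E : I -> set W),
    [/\ i0 \notin A, forall i, F i (E i), forall i, i \notin A -> E i = setT &
        C = \bigcap_i E i]].

Let capE (A : {fset I}) (E : I -> set W) : (forall i, i \notin A -> E i = setT) ->
  \bigcap_i E i = \bigcap_(i in [set` A]) E i.
Proof.
move=> ET; apply/seteqP; split => om H i; first by move=> _; exact: H.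
by move=> _; have [iA|/ET ->//] := boolP (i \in A); exact: H.
Qed.

Lemma cylinders_setI i0 : setI_closed (cylinders i0).
Proof.
move=> _ _ [A [E [iA FE ET ->]]] [A' [E' [iA' FE' ET' ->]]].
exists (A `|` A')%fset, (fun i => E i `&` E' i); split.
- by rewrite inE negb_or iA iA'.
- by move=> i; exact: sigma_algebra_setI.
- by move=> i; rewrite inE negb_or => /andP[/ET -> /ET' ->]; rewrite setTI.
- by rewrite bigcapI.
Qed.

Lemma cylinders_single i0 i (E : set W) : i != i0 -> F i E -> cylinders i0 E.
Proof.
move=> ii0 FE; exists [fset i]%fset, (fun k => if k == i then E else setT); split.
- by rewrite inE eq_sym.
- by move=> k; case: eqP => [->//|_]; exact: sigma_algebra_setT.
- by move=> k; rewrite inE => /negbTE ->.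
- apply/seteqP; split => om; first by move=> Eom k _; case: ifP.
  by move=> H; have := H i; rewrite eqxx; apply.
Qed.

(** As functions of [C] both sides are finite measures; they agree on a pi-system by mutual
    independence, hence on the sigma-algebra it generates. *)
Lemma independent_cylinders i0 (E0 C : set W) : F i0 E0 ->
  <<s cylinders i0 >> C -> P (C `&` E0) = (P C * P E0)%E.
Proof.
move=> FE0; have mE0 := mF FE0.
have cT : cylinders i0 setT.
  exists fset0, (fun=> setT); split => //.
  - by move=> i; exact: sigma_algebra_setT.
  - by apply/seteqP; split.
have cM : cylinders i0 `<=` measurable.
  move=> _ [A [E [_ FE ET ->]]]; rewrite (capE ET).
  by apply: fin_bigcap_measurable => // i _; exact: mF (FE i).
have PE0 : P E0 = (fine (P E0))%:E by rewrite fineK// fin_num_measure.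
pose c : {nonneg R} := NngNum (fine_ge0 (measure_ge0 P E0)).
rewrite muleC PE0.
apply: (@g_sigma_algebra_measure_unique _ _ _ (cylinders i0) cM (fun=> setT) _ _
  (mrestr P mE0) (mscale c P)) => //.
- by apply/seteqP; split => // om _; exists 0.
- exact: cylinders_setI.
- move=> _ [A [E [i0A FE ET ->]]].
  change (P (\bigcap_i E i `&` E0) = ((fine (P E0))%:E * P (\bigcap_i E i))%E).
  rewrite -PE0 (capE ET).
  have PA : P (\bigcap_(i in [set` A]) E i) = (\prod_(i <- A) P (E i))%E.
    by apply: indF => i _; exact: FE.
  pose E' i := if i == i0 then E0 else E i.
  have PA0 : P (\bigcap_(i in [set` (i0 |` A)%fset]) E' i) =
      (\prod_(i <- (i0 |` A)%fset) P (E' i))%E.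
    by apply: indF => i _; rewrite /E'; case: eqP => [->//|_]; exact: FE.
  rewrite (_ : _ `&` _ = \bigcap_(i in [set` (i0 |` A)%fset]) E' i).
    rewrite PA0 PA big_fsetU1//= {1}/E' eqxx; congr (_ * _)%E.
    apply: eq_big_seq => i iA; rewrite /E'; case: eqP => // ii0.
    by move: i0A; rewrite -ii0 iA.
  apply/seteqP; split => om.
    move=> [H E0om] i /=; rewrite /E' !inE; case: eqP => [_ _ //|_ /= iA].
    exact: (H i iA).
  move=> H; split; last first.
    by have := H i0; rewrite /E' eqxx /=; apply; rewrite !inE eqxx.
  move=> i /= iA; have := H i; rewrite /= /E'; case: eqP => [ii0|_].
    by move: i0A; rewrite -ii0 iA.
  by apply; rewrite !inE iA orbT.
- move=> k; change (P (setT `&` E0) < +oo)%E.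
  by rewrite setTI ltey_eq fin_num_measure.
Qed.

End Independence.

(** * Freshness of the noise coordinates of a random seed *)

Section RandomSeed.
Context {R : realType} {g : nat} {s : setup R g}.
Context {disp : measure_display} {W : measurableType disp} {P : probability W R}.
Variables (q : R) (X : random_seed s P).
Hypothesis lawX : seed_law q X.

Definition seed_coords (om : W) : @coords R (seed_coord s) := fun a =>
  match a with
  | inl (inl (j, i, c)) => rtargets X j i c om
  | inl (inr (k, t, i)) => (rbits X k t i om)%:R
  | inr (k, t, c) => rnoises X k t c om
  end.

(** All target entries of one guest share a source, their joint law being arbitrary; every bit and
    every noise coordinate is a source of its own. *)
Definition source_of (a : seed_coord s) : source g :=
  match a with
  | inl (inl (j, i, c)) => inl (inl j)
  | inl (inr kti) => inl (inr kti)
  | inr ktc => inr ktc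
  end.

Lemma seed_of_coords om : @seed_of R g s (seed_coords om) = seed_at X om.
Proof.
rewrite /seed_of /seed_at; congr Seed.
do 3 apply/funext => ?; rewrite /seed_coords.
by case: (rbits X _ _ _ om); rewrite ?eqxx// eq_sym oner_eq0.
Qed.

Lemma measurable_random_bit k t i :
  measurable_fun setT (fun om => (rbits X k t i om)%:R : R).
Proof.
rewrite (_ : (fun om => _) = fun om => if rbits X k t i om then 1 else 0).
  exact: measurable_fun_ifT.
by apply/funext => om; case: (rbits X k t i om).
Qed.

Lemma measurable_seed_coords : measurable_fun setT seed_coords.
Proof.
apply: measurable_coords => -[[[[j i] c]|[[k t] i]]|[[k t] c]] /=.
- exact: measurable_funPT.
- exact: measurable_random_bit.
- exact: measurable_funPT.
Qed.

Lemma source_events_sigma_algebra a : sigma_algebra setT (source_events X a).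
Proof.
case: a => [[j|[[k t] i]]|[[k t] c]] /=; first exact: smallest_sigma_algebra.
- by apply: sigma_algebra_preimage; exact: sigma_algebra_measurable.
- by apply: sigma_algebra_preimage; exact: sigma_algebra_measurable.
Qed.

Lemma source_events_measurable a : source_events X a `<=` measurable.
Proof.
case: a => [[j|[[k t] i]]|[[k t] c]] E /=.
- apply: (sigma_of_preimage (f := idfun)) => -[i c]; exact: measurable_funPT.
- by move=> [B mB <-]; exact: measurable_funPT.
- by move=> [B mB <-]; exact: measurable_funPT.
Qed.

Lemma source_event_coord (a : seed_coord s) (B : set R) : measurable B ->
  source_events X (source_of a) ((fun om => seed_coords om a) @^-1` B).
Proof.
move=> mB; case: a => [[[[j i] c]|[[k t] i]]|[[k t] c]] /=.
- exact: (@sigma_of_gen W (nat * 'I_(rdim s)) _ _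
    (fun ic => rtargets X j ic.1 ic.2 : W -> R) (i, c) B mB).
- exists ((fun b : bool => b%:R : R) @^-1` B) => //.
  by rewrite setTI.
- by exists B => //; rewrite setTI.
Qed.

Lemma fresh_gaussian_noise k t c :
  fresh_gaussian (P := P) seed_coords (inr (k, t, c)).
Proof.
case: lawX => _ lawN indep E B mE mB.
rewrite -(lawN k t c B mB).
have := @independent_cylinders _ _ _ P _ _ source_events_sigma_algebra
  source_events_measurable indep (inr (k, t, c)).
apply.
  by exists B => //; rewrite setTI.
apply: (sigma_of_preimage_sub (X := fun a (v : seed_coord s -> R) => v a) _ _ mE).
  exact: smallest_sigma_algebra.
move=> a B' mB'.
change (<<s cylinders (F := source_events X) (inr (k, t, c)) >>
  [set om | B' (if a == inr (k, t, c) then 0 else seed_coords om a)]).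
case: eqVneq => [_|ac].
  have sC := smallest_sigma_algebra setT
    (cylinders (F := source_events X) (inr (k, t, c))).
  (* The erased coordinate is constantly 0, so the event is everything or empty. *)
  have [B0|B0] := pselect (B' 0).
    rewrite (_ : [set _ | _] = setT); first exact: sigma_algebra_setT.
    by apply/seteqP; split.
  rewrite (_ : [set _ | _] = set0); first by case: sC.
  by apply/seteqP; split.
apply: sub_sigma_algebra; apply: cylinders_single (source_event_coord a mB').
  exact: source_events_sigma_algebra.
by move: a ac => [[[[j i] c']|]|].
Qed.

End RandomSeed.

(** * Privacy *)

Lemma eq_indic (R : pzRingType) (T U : Type) (A : set T) (B : set U) x y :
  A x = B y -> \1_A x = \1_B y :> R.
Proof.
move=> AB; rewrite !indicE (_ : (x \in A) = (y \in B))//.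
by apply/idP/idP; rewrite !inE AB.
Qed.

Section Privacy.
Context {R : realType} {g : nat} {s : setup R g}.
Context {disp : measure_display} {W : measurableType disp} {P : probability W R}.
Variables (q : R) (X : random_seed s P) (T : 'I_g.+1 -> nat) (sigma : R).
Hypothesis adm : admissible s.
Hypothesis lawX : seed_law q X.

Lemma measurable_fedonce_event (D : dataset s) (S : set (output s)) :
  output_events S -> measurable [set om | S (fedonce T sigma D (seed_at X om))].
Proof.
apply: measurable_fedonce => // j i a c.
by under eq_fun do rewrite mxE; exact: measurable_funPT.
Qed.

(* The datasets are arbitrary: clipping alone bounds the effect of changing
   them. *)
Lemma fedonce_gaussian (D D' : dataset s) (S : set (output s)) (l u : R) :
  0 < sigma -> 0 <= l -> output_events S ->
  (fedonce_law T sigma X D S <= (expR u)%:E * fedonce_law T sigma X D' S +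
   (expR (l * (l + 1) / 2 * (4 * (\sum_k T k)%:R / sigma ^+ 2) - l * u))%:E)%E.
Proof.
move=> sigma0 l0 oS.
pose F (v : @coords R (seed_coord s)) : \bar R :=
  (\1_[set v | S (fedonce T sigma D' (seed_of v))] v)%:E.
pose cs := noise_coords s T.
pose h := noise_shift T sigma D D'.
have F01 v : (0 <= F v <= 1)%E.
  by rewrite /F indicE; case: (_ \in _); rewrite ?lexx ?lee01.
have F0 v : (0 <= F v)%E by case/andP: (F01 v).
have mE E : measurable [set v : @coords R (seed_coord s) |
    S (fedonce T sigma E (seed_of v))].
  apply: measurable_fedonce => //.
  - exact: measurable_seed_targets.
  - exact: measurable_seed_bits.
  - exact: measurable_seed_noises.
have mF : measurable_fun setT F.
  by apply/measurable_EFinP; exact: measurable_indic.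
have mX := measurable_seed_coords X.
have lawE E : fedonce_law T sigma X E S =
    (\int[P]_om (\1_[set v | S (fedonce T sigma E (seed_of v))]
                   (seed_coords X om))%:E)%E.
  transitivity (\int[P]_om
      (\1_[set om | S (fedonce T sigma E (seed_at X om))] om)%:E)%E.
    by rewrite integral_indic ?setIT//; exact: measurable_fedonce_event.
  apply: eq_integral => om _; apply: (congr1 EFin); apply: eq_indic.
  by rewrite /mkset seed_of_coords.
have fresh a : a \in cs -> fresh_gaussian (P := P) (seed_coords X) a.
  rewrite mem_sort => /mapP[[[k t] c] _ ->].
  exact: fresh_gaussian_noise lawX _ _ _.
(* The event for the run on [D] is the event for the run on [D'] at the shifted noise. *)
have Fshift v : F (shifted h cs v) =
    (\1_[set v | S (fedonce T sigma D (seed_of v))] v)%:E.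
  by apply: (congr1 EFin); apply: eq_indic; rewrite /mkset fedonce_shift.
have mFs : measurable_fun setT (F \o shifted h cs).
  rewrite (_ : _ \o _ = fun v =>
    (\1_[set v | S (fedonce T sigma D (seed_of v))] v)%:E).
    by apply/measurable_EFinP; exact: measurable_indic.
  by apply/funext => v; exact: Fshift.
have -> : fedonce_law T sigma X D S =
    (\int[P]_om avg cs (F \o shifted h cs) (seed_coords X om))%E.
  refine (etrans _ (integral_avg mX fresh (fun v => F0 (shifted h cs v)) mFs)).
  by rewrite lawE; apply: eq_integral => om _; exact/esym/Fshift.
have -> : fedonce_law T sigma X D' S =
    (\int[P]_om avg cs F (seed_coords X om))%E.
  by refine (etrans _ (integral_avg mX fresh F0 mF)); exact: lawE.
have mavg : measurable_fun setT (fun om => avg cs F (seed_coords X om)).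
  exact: (measurableT_comp (measurable_avg cs F0 mF)).
pose c := expR (l * (l + 1) / 2 * (4 * (\sum_k T k)%:R / sigma ^+ 2) - l * u).
(* Both laws are now averages over the same random seed, so [avg_shift_le] compares them
   pointwise. *)
apply: (@le_trans _ _
  (\int[P]_om ((expR u)%:E * avg cs F (seed_coords X om) + c%:E))%E).
  apply: ge0_le_integral => //.
  - by move=> om _; apply: avg_ge0 => v; exact: F0.
  - apply: (measurableT_comp (measurable_avg cs _ mFs)) => //.
    by move=> v; exact: F0.
  - by apply: emeasurable_funD => //; exact: emeasurable_funM.
  move=> om _; apply: avg_shift_le => //.
  - by move=> a; exact: measurable_noise_shift.
  - exact: predictable_noise_shift.
  - by move=> v; exact: sum_noise_shift.
rewrite ge0_integralD//; last 3 first.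
- by move=> om _; rewrite mule_ge0// ?lee_fin ?expR_ge0// avg_ge0.
- exact: emeasurable_funM.
- by move=> om _; rewrite lee_fin expR_ge0.
rewrite ge0_integralZl//; last by move=> om _; exact: avg_ge0.
by rewrite integral_cst//= probability_setT mule1.
Qed.

Lemma filter_records_rem1 (D : dataset s) i (p : pred (nat * sample s)) :
  (forall e, e.1 = i -> ~~ p e) ->
  [seq e <- records D.[~ i]%fmap | p e] = [seq e <- records D | p e].
Proof.
move=> pi; rewrite /records.
(* Both lists are sorted, duplicate-free and have the same elements. *)
have -> : sort leq (domf D.[~ i]%fmap) = [seq j <- sort leq (domf D) | j != i].
  apply: (sorted_eq leq_trans anti_leq).
  - exact/sort_sorted/leq_total.
  - apply: sorted_filter; first exact: leq_trans.
    exact/sort_sorted/leq_total.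
  apply: uniq_perm; rewrite ?filter_uniq ?sort_uniq ?fset_uniq// => j.
  by rewrite mem_filter !mem_sort -[j \in _]/(j \in D.[~ i]%fmap) mem_remf1.
elim: (sort _ _) => //= j l IH; have [->|ji] := eqVneq j i; rewrite /=.
  rewrite IH; case: (D.[? i])%fmap => //= x.
  by rewrite (negbTE (pi (i, x) erefl)).
rewrite fnd_rem1 ji; case: (D.[? j])%fmap => //= x.
by rewrite IH.
Qed.

(** Data enter the training only through the batches of the epochs performed. *)
Lemma eq_fedonce (D D' : dataset s) (r : seed s) :
  (forall k t, (t < T k)%N -> batch D r k t = batch D' r k t) ->
  fedonce T sigma D r = fedonce T sigma D' r.
Proof.
move=> DD'.
have guestE j t : (t <= T (lift ord0 j))%N ->
    guest_run sigma D r j t = guest_run sigma D' r j t.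
  elim: t => [//|t IH] tT.
  by rewrite !guest_runS (IH (ltnW tT)) (DD' _ _ tT).
have repE : representation T sigma D r = representation T sigma D' r.
  have finalE j : guest_final T sigma D r j = guest_final T sigma D' r j.
    exact: guestE.
  by apply/funext => x; apply: eq_mx => j b; rewrite finalE.
have hostE rep t : (t <= T ord0)%N ->
    host_run sigma D r rep t = host_run sigma D' r rep t.
  elim: t => [//|t IH] tT.
  by rewrite !host_runS (IH (ltnW tT)) (DD' _ _ tT).
have hostF E : host_final T sigma E r =
    host_run sigma E r (representation T sigma E r) (T ord0) by [].
have e1 : guest_final T sigma D r = guest_final T sigma D' r.
  by apply: functional_extensionality_dep => j; exact: guestE.
have e2 : host_final T sigma D r = host_final T sigma D' r.
  by rewrite !hostF repE; exact: hostE.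
exact: (congr2 pair e1 e2).
Qed.

Hypothesis q01 : 0 < q < 1.

Lemma prob_bit_false k t i : P (rbits X k t i @^-1` [set false]) = (1 - q)%:E.
Proof.
case: lawX => lawB _ _.
transitivity (distribution P (rbits X k t i) [set false]); first by [].
rewrite lawB//.
rewrite bernoulli_probE; last by case/andP: q01 => /ltW -> /ltW ->.
rewrite !diracE (_ : (true \in _) = false); last by apply/negbTE; rewrite notin_setE.
rewrite (_ : (false \in _) = true); last exact: mem_set.
by rewrite mule0 add0e mule1.
Qed.

Definition batch_sources (i : nat) : seq (source g) :=
  flatten [seq [seq inl (inr (k, t, i)) | t <- iota 0 (T k)] | k <- enum 'I_g.+1].

Definition never_drawn (i : nat) : set W :=
  [set om | forall k t, (t < T k)%N -> rbits X k t i om = false].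

(** Independence gives a power of [1 - q] with one factor per draw bit of index [i]. Bounding their
    number by [\sum_k T k] is enough, as [1 - q <= 1]. *)
Lemma never_drawnP i : measurable (never_drawn i) /\
  (((1 - q) ^+ (\sum_k T k))%:E <= P (never_drawn i))%E.
Proof.
pose A : {fset source g} := seq_fset tt (batch_sources i).
pose E (a : source g) : set W :=
  if a is inl (inr (k, t, i)) then rbits X k t i @^-1` [set false] else setT.
have AE : never_drawn i = \bigcap_(a in [set` A]) E a.
  apply/seteqP; split => om H.
    move=> a /=; rewrite seq_fsetE => /flattenP[_ /mapP[k _ ->] /mapP[t tT ->]] /=.
    by apply: H; move: tT; rewrite mem_iota.
  move=> k t tT; apply: (H (inl (inr (k, t, i)))) => /=; rewrite seq_fsetE.
  apply/flattenP; exists [seq inl (inr (k, t, i)) | t <- iota 0 (T k)].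
    by apply/mapP; exists k; rewrite ?mem_enum.
  by apply/mapP; exists t; rewrite ?mem_iota.
have Aform a : a \in A -> exists k t, a = inl (inr (k, t, i)).
  rewrite seq_fsetE => /flattenP[_ /mapP[k _ ->] /mapP[t _ ->]].
  by exists k, t.
have AF a : a \in A -> source_events X a (E a).
  move=> /Aform[k [t ->]] /=; exists [set false] => //.
  by rewrite setTI.
split.
  rewrite AE; apply: fin_bigcap_measurable => // a aA.
  exact: source_events_measurable (AF a aA).
case: lawX => _ _ indep; rewrite AE indep//.
rewrite (eq_big_seq (fun=> (1 - q)%:E)); last first.
  by move=> a /Aform[k [t ->]]; exact: prob_bit_false.
rewrite prodEFin lee_fin big_const_seq count_predT -Monoid.iteropE.
rewrite -[X in _ <= X]/((1 - q) ^+ #|` A|).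
have p01 : 0 <= 1 - q <= 1.
  by case/andP: q01 => q0 q1; rewrite subr_ge0 (ltW q1) gerBl ltW.
apply: ler_wiXn2l; [by case/andP: p01|by case/andP: p01|].
rewrite /A size_seq_fset (leq_trans (size_undup _))//.
rewrite size_flatten /shape -map_comp sumnE big_map big_enum/=.
by apply: leq_sum => k _; rewrite size_map size_iota.
Qed.

(** If the differing index is never drawn, all batches and hence the outputs coincide; a union bound
    pays for the complement. *)
Lemma fedonce_never_drawn (D D' : dataset s) (S : set (output s)) :
  neighbors D D' -> output_events S ->
  (fedonce_law T sigma X D S <= fedonce_law T sigma X D' S +
     (1 - (1 - q) ^+ (\sum_k T k))%:E)%E.
Proof.
move=> [i DD'] oS; have [mN PN] := never_drawnP i.
have batchE E r k t : bits r k t i = false ->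
    batch (E.[~ i]%fmap : dataset s) r k t = batch E r k t.
  by move=> ri; apply: filter_records_rem1 => e ->; rewrite ri.
have sub : [set om | S (fedonce T sigma D (seed_at X om))] `<=`
    [set om | S (fedonce T sigma D' (seed_at X om))] `|` ~` never_drawn i.
  move=> om Som; have [Nom|] := pselect (never_drawn i om); last by right.
  left; rewrite /= (@eq_fedonce D' D)// => k t tT.
  by case: DD' => ->; rewrite batchE//; exact: Nom.
have PC : (P (~` never_drawn i) <= (1 - (1 - q) ^+ (\sum_k T k))%:E)%E.
  by rewrite probability_setC// EFinB; exact: leeB.
have mD := measurable_fedonce_event D oS.
have mD' := measurable_fedonce_event D' oS.
apply: le_trans (le_measure _ _ _ sub) _; rewrite ?inE//.
  by apply: measurableU => //; exact: measurableC.
apply: le_trans (measureU2 _ _ _) _ => //; first exact: measurableC.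
exact: leeD.
Qed.

End Privacy.

(** * Choice of the exponent and of the constants *)

(** Here [s] stands for the squared noise scale, [n] for the total number of epochs and [L] for
    log(1/delta). In [m], the summand 16 serves the final bound by [- L], and [8 / L0] gives
    [8 <= m ^+ 2 * L]. *)
Lemma noise_scale_exponent (R : realFieldType) (eps L L0 n m s : R) :
  0 < eps -> eps <= 1 -> 1 <= n -> 0 < L0 -> L0 <= L ->
  m = 16 + 8 / L0 -> m ^+ 2 * L * n / eps ^+ 2 <= s ->
  exists2 l : R, 0 <= l & l * (l + 1) / 2 * (4 * n / s) - l * eps <= - L.
Proof.
move=> e0 e1 n1 L00 L0L mE hs.
have L_gt0 : 0 < L by exact: lt_le_trans L0L.
have n0 : 0 < n by exact: lt_le_trans n1.
have i0 : 0 < 8 / L0 by rewrite divr_gt0.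
have m16 : 16 <= m by rewrite mE lerDl ltW.
have m0 : 0 < m by rewrite (lt_le_trans _ m16).
have mm : m <= m ^+ 2.
  by rewrite expr2 ler_peMl// ?(ltW m0)// (le_trans _ m16)// ler1n.
have mL8 : 8 <= m ^+ 2 * L.
  have : 8 / L0 * L0 <= m ^+ 2 * L.
    rewrite ler_pM// ?(ltW i0) ?(ltW L00)//.
    by rewrite (le_trans _ mm)// mE lerDr.
  by rewrite divfK ?gt_eqF.
have hs' : m ^+ 2 * L * n <= s * eps ^+ 2.
  by rewrite -ler_pdivrMr// exprn_gt0.
have s0 : 0 < s.
  by apply: lt_le_trans hs; rewrite divr_gt0 ?exprn_gt0// !mulr_gt0// exprn_gt0.
(* With this [l] the quadratic term uses a quarter of [l * eps]. By [h2] the linear term uses at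
   most another quarter, so at least half of the gain is left. *)
exists (eps * s / (8 * n)).
  by rewrite divr_ge0 ?mulr_ge0// ltW.
set l := eps * s / (8 * n).
have l0 : 0 <= l by rewrite divr_ge0 ?mulr_ge0// ltW.
have lE : l * (2 * n / s) = eps / 4 by rewrite /l; field; rewrite !gt_eqF.
(* The hypothesis on [s] yields a bound in [eps ^+ 2]; [eps <= 1] turns it into one in [eps]. *)
have h2 : 2 * n / s <= eps / 4.
  rewrite ler_pdivrMr//.
  have : 8 * n <= s * eps ^+ 2.
    by apply: le_trans hs'; rewrite ler_pM2r.
  have : s * eps ^+ 2 <= s * eps.
    by rewrite ler_pM2l// expr2 ler_piMr// ltW.
  by lra.
have -> : l * (l + 1) / 2 * (4 * n / s) - l * eps =
    l * (l * (2 * n / s) + 2 * n / s - eps) by field; rewrite gt_eqF.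
rewrite lE.
apply: (@le_trans _ _ (l * (- (eps / 2)))).
  by rewrite ler_wpM2l//; lra.
have -> : l * - (eps / 2) = - (s * eps ^+ 2 / (16 * n)).
  by rewrite /l; field; rewrite gt_eqF.
rewrite lerN2 ler_pdivlMr ?mulr_gt0//.
apply: le_trans hs'; rewrite mulrCA mulrA ler_pM2r// ler_pM2r//.
by rewrite (le_trans m16).
Qed.

Theorem theorem4 (R : realType) (g : nat) (hg : (0 < g)%N) (q : R)
    (hq : 0 < q < 1) (T : 'I_g.+1 -> nat) :
  exists c1 c2 : R, [/\ 0 < c1, 0 < c2 &
    forall (s : setup R g) (disp : measure_display) (W : measurableType disp)
      (P : probability W R) (X : random_seed s P) (eps delta sigma : R),
      admissible s -> seed_law q X ->
      0 < eps < c1 * q ^+ 2 * (\sum_j T j)%:R ->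
      0 < delta <= 1 ->
      c2 * (q * Num.sqrt (ln (1 / delta) * (\sum_j T j)%:R) / eps) <= sigma ->
      differentially_private (@neighbors R g s) (@output_events R g s)
        (fedonce_law T sigma X) eps delta].
Proof.
have /andP[q0 q1] := hq.
set N := (\sum_j T j)%N.
(* Without any epoch the range of [eps] is empty. *)
have [N0|N_gt0] := posnP N.
  exists 1, 1; split => // s disp W P X eps delta sigma _ _.
  by rewrite N0 mulr0 => /andP[e0 /(lt_trans e0)]; rewrite ltxx.
have n1 : 1 <= N%:R :> R by rewrite ler1n.
have n0 : 0 < N%:R :> R by rewrite ltr0n.
pose p0 : R := (1 - q) ^+ N.
have p0_gt0 : 0 < p0 by rewrite exprn_gt0// subr_gt0.
have p0_lt1 : p0 < 1.
  by rewrite exprn_ilt1// ?subr_ge0 ?(ltW q1)// ?gtrBl// -lt0n.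
(* The value of log(1/delta) at the threshold [delta = 1 - p0], positive because [0 < p0 < 1]. *)
pose L0 := ln (1 - p0)^-1.
have L00 : 0 < L0.
  rewrite ln_gt0// invf_gt1 ?subr_gt0// gtrBl//.
pose m := 16 + 8 / L0.
have m0 : 0 < m by rewrite addr_gt0// divr_gt0.
(* The first constant turns the range of [eps] into [0 < eps < 1]; in the second, [1 / q] cancels
   the [q] of the noise bound. *)
exists (q ^+ 2 * N%:R)^-1, (m / q); split.
- by rewrite invr_gt0 mulr_gt0// exprn_gt0.
- by rewrite divr_gt0.
move=> s disp W P X eps delta sigma adm lawX.
rewrite -mulrA mulVf ?gt_eqF ?mulr_gt0 ?exprn_gt0// => /andP[e0 e1] /andP[d0 d1] hs.
move=> D D' DD' S oS.
have [dp|dp] := leP (1 - p0) delta.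
  apply: le_trans (fedonce_never_drawn T sigma adm lawX hq DD' oS) _.
  apply: leeD; last by rewrite lee_fin.
  rewrite lee_pemull ?measure_ge0// lee_fin -[leLHS]expR0 ler_expR.
  exact: ltW.
have L0L : L0 <= ln (1 / delta).
  rewrite div1r ler_ln ?posrE ?invr_gt0 ?subr_gt0//.
  by rewrite lef_pV2 ?posrE ?subr_gt0// ltW.
have L_gt0 : 0 < ln (1 / delta) by exact: lt_le_trans L0L.
have hs1 : m * Num.sqrt (ln (1 / delta) * N%:R) / eps <= sigma.
  by apply: le_trans hs; rewrite !mulrA divfK ?gt_eqF.
have x0 : 0 < m * Num.sqrt (ln (1 / delta) * N%:R) / eps.
  by rewrite divr_gt0// mulr_gt0// sqrtr_gt0 mulr_gt0.
have sigma0 : 0 < sigma by exact: lt_le_trans hs1.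
have hs2 : m ^+ 2 * ln (1 / delta) * N%:R / eps ^+ 2 <= sigma ^+ 2.
  have : (m * Num.sqrt (ln (1 / delta) * N%:R) / eps) ^+ 2 <= sigma ^+ 2.
    by rewrite ler_sqr ?nnegrE ?(ltW x0) ?(ltW sigma0).
  rewrite !exprMn sqr_sqrtr; last by rewrite mulr_ge0 ?(ltW L_gt0) ?(ltW n0).
  by rewrite exprVn mulrA.
have [l l0 hl] := noise_scale_exponent e0 (ltW e1) n1 L00 L0L (erefl m) hs2.
(* Taken with [u = eps]; the additive term is at most exp(- log(1/delta)) = delta by the choice of
   [l]. *)
apply: le_trans (fedonce_gaussian T adm lawX D D' eps sigma0 l0 oS) _.
rewrite leeD2l// lee_fin -[leRHS]lnK ?posrE// ler_expR.
by move: hl; rewrite div1r lnV ?posrE// opprK.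
Qed.
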